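(* Let $\nu>0$, let $f_1,\dots,f_n:\mathbb{R}^p\to\mathbb{R}$ be twice differentiable, with each $f_i$ convex and $L_i$-smooth, let $F_i(w)=f_i(w)+\frac\nu2\|w\|^2$, and let $F=\frac1n\sum_{i=1}^nF_i$ with minimizer $w_\star$. Let $\varepsilon_0\in(0,1/6]$. Suppose each $F_i$ has an $M$-Lipschitz Hessian, and that the initial point satisfies $w_0\in\mathcal N_{\varepsilon_0}(w_\star)$, where $$\mathcal N_{\varepsilon_0}(w_\star)=\left\{w\in\mathbb{R}^p:\|w-w_\star\|_{\nabla^2F(w_\star)}\le\frac{\varepsilon_0\nu^{3/2}}{2M}\right\}.$$ Suppose the preconditioner $P$ constructed at $w_0$ is symmetric positive definite and satisfies $(1-\varepsilon_0)P\preceq\nabla^2F(w_0)\preceq(1+\varepsilon_0)P$. Run SketchySVRG from $\hat w^{(0)}=w_0$ using Option I with $\mathcal U=\{0\}$, $m=6$ inner iterations, $s=2\log(1/\epsilon)$ outer iterations, $\eta=1$, and gradient batchsize $b_g=\widetilde{\mathcal O}\left(\tau_\star^\nu(\mathcal N_{\varepsilon_0}(w_\star))\log(\frac1\delta)\right)$. Then with probability at least $1-\delta$, $$F(\hat w^{(s)})-F(w_\star)\le\epsilon.$$ Hence the total number of stochastic gradient queries required to reach an $\epsilon$-suboptimal point is bounded by $$3\left[n+6\,\widetilde{\mathcal O}\left(\tau_\star^\nu(\mathcal N_{\varepsilon_0}(w_\star))\log\left(\frac1\delta\right)\right)\right]\log\left(\frac{1}{\epsilon}\right).$$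
   Context: Notation. $\|x\|_A^2=x^TAx$; $\preceq$ is the Loewner order; $\lambda_1$ is the largest eigenvalue; $[n]=\{1,\dots,n\}$; $f=\frac1n\sum_if_i$. For a minibatch $\mathcal B\subseteq[n]$ with $|\mathcal B|=b_g$, sampled uniformly without replacement, $\widehat\nabla F(w)=\frac1{b_g}\sum_{i\in\mathcal B}\nabla f_i(w)+\nu w$. $\widetilde{\mathcal O}$ hides universal constants and (poly)logarithmic factors; ''$b_g=\widetilde{\mathcal O}(\cdot)$'' means the conclusion holds for a suitable batchsize of that order. Hessian dissimilarity over a closed convex set $\mathcal C$: $\tau_\star^\nu(\mathcal C)=\sup_{w\in\mathcal C}\max_{1\le i\le n}\lambda_1\left((\nabla^2f(w)+\nu I)^{-1/2}(\nabla^2f_i(w)+\nu I)(\nabla^2f(w)+\nu I)^{-1/2}\right)$. SketchySVRG. Inputs: initial point $\hat w^{(0)}$, batchsize $b_g$, a set $\mathcal U\subseteq\mathbb{N}$ of preconditioner update times, learning rate $\eta$, number $m$ of inner iterations. For $s=0,1,\dots$ (outer loop): compute $\nabla F(\hat w^{(s)})$ and set $w_0^{(s)}=\hat w^{(s)}$. For $k=0,\dots,m-1$ (inner loop): if $ms+k\in\mathcal U$, construct a new preconditioner at $w_k^{(s)}$ (otherwise keep the previous one; so with $\mathcal U=\{0\}$ a single preconditioner $P$, constructed at the initial point, is used throughout); with $P$ the current preconditioner, sample a fresh minibatch $\mathcal B$ of size $b_g$, form $v_k^{(s)}=\widehat\nabla F(w_k^{(s)})-\widehat\nabla F(\hat w^{(s)})+\nabla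 F(\hat w^{(s)})$ (same $\mathcal B$ in both stochastic gradients), and set $w_{k+1}^{(s)}=w_k^{(s)}-\eta P^{-1}v_k^{(s)}$. After the inner loop, Option I: $\hat w^{(s+1)}=w_m^{(s)}$. Stochastic gradient queries are counted as $n$ per outer iteration plus $b_g$ per inner iteration.
   Formalization: Added: ε·(F(w₀)−F(w⋆)) ≤ 1, since absolute accuracy ε fails for large initial gaps; s is rounded up and the query bound is stated for ε ≤ 1/2, as it fails for ε near 1. Õ is read as K·τ·(1+log(1/δ))·(1+log(1+log(1/ε))), as b_g ≥ 1. *)

(* Defs.v *)
From HB Require Import structures.
From mathcomp Require Import all_boot all_order all_algebra.
From mathcomp Require Import all_classical all_reals all_analysis.

Set Implicit Arguments.
Unset Strict Implicit.
Unset Printing Implicit Defensive.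

Import Order.TTheory GRing.Theory Num.Theory.
Import numFieldNormedType.Exports.

Local Open Scope classical_set_scope.
Local Open Scope ring_scope.

(** ** Euclidean geometry and symmetric matrices *)

(* The library norm on matrices is the sup norm, hence these Euclidean ones. *)
Definition qform (R : realType) (p : nat) (A : 'M[R]_p) (x : 'cV[R]_p) : R :=
  (x^T *m A *m x) 0 0.

Definition wnorm (R : realType) (p : nat) (A : 'M[R]_p) (x : 'cV[R]_p) : R :=
  Num.sqrt (qform A x).

Definition norm2 (R : realType) (p : nat) (x : 'cV[R]_p) : R := wnorm 1%:M x.

Definition psd (R : realType) (p : nat) (A : 'M[R]_p) : Prop :=
  A^T = A /\ forall x : 'cV[R]_p, 0 <= qform A x.

Definition spd (R : realType) (p : nat) (A : 'M[R]_p) : Prop :=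
  A^T = A /\ forall x : 'cV[R]_p, x != 0 -> 0 < qform A x.

Definition loewner_le (R : realType) (p : nat) (A B : 'M[R]_p) : Prop :=
  psd (B - A).

(* [opnorm_le A c] says that the spectral norm of A is at most c. *)
Definition opnorm_le (R : realType) (p : nat) (A : 'M[R]_p) (c : R) : Prop :=
  forall x : 'cV[R]_p, norm2 (A *m x) <= c * norm2 x.

Definition lambda1 (R : realType) (p : nat) (A : 'M[R]_p) : R :=
  sup [set a : R | eigenvalue A a].

(* A^{-1/2} for A symmetric positive definite: the unique symmetric positive
   definite square root of A^{-1}. *)
Definition inv_sqrtmx (R : realType) (p : nat) (A : 'M[R]_p) : 'M[R]_p :=
  get [set S : 'M[R]_p | spd S /\ S *m S = invmx A].

(** ** Differential calculus on R^p *)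

Definition gradient (R : realType) (p : nat) (g : 'cV[R]_p -> R)
    (x : 'cV[R]_p) : 'cV[R]_p :=
  \col_i 'D_(delta_mx i 0) g x.

Definition hessian (R : realType) (p : nat) (g : 'cV[R]_p -> R)
    (x : 'cV[R]_p) : 'M[R]_p :=
  \matrix_(i, j) 'D_(delta_mx j 0) (fun y : 'cV[R]_p => gradient g y i 0) x.

Definition twice_differentiable (R : realType) (p : nat)
    (g : 'cV[R]_p -> R) : Prop :=
  forall x : 'cV[R]_p, differentiable g x /\ differentiable (gradient g) x.

Definition smooth (R : realType) (p : nat) (L : R) (g : 'cV[R]_p -> R) : Prop :=
  forall x y : 'cV[R]_p,
    norm2 (gradient g x - gradient g y) <= L * norm2 (x - y).

Definition lipschitz_hessian (R : realType) (p : nat) (M : R)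
    (g : 'cV[R]_p -> R) : Prop :=
  forall x y : 'cV[R]_p,
    opnorm_le (hessian g x - hessian g y) (M * norm2 (x - y)).

(** ** The finite-sum objective *)

Definition regularized (R : realType) (p : nat) (nu : R)
    (g : 'cV[R]_p -> R) (w : 'cV[R]_p) : R :=
  g w + nu / 2 * norm2 w ^+ 2.

Definition average (R : realType) (p n : nat) (g : 'I_n -> 'cV[R]_p -> R)
    (w : 'cV[R]_p) : R :=
  n%:R^-1 * \sum_(i < n) g i w.

Definition objective (R : realType) (p n : nat) (nu : R)
    (f : 'I_n -> 'cV[R]_p -> R) : 'cV[R]_p -> R :=
  average (fun i => regularized nu (f i)).

Definition is_minimizer (R : realType) (p : nat) (g : 'cV[R]_p -> R)
    (w : 'cV[R]_p) : Prop :=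
  forall x : 'cV[R]_p, g w <= g x.

(* The base value 0 of the maximum is immaterial: for convex f_i and 0 < nu the
   matrices below are positive definite.  Since the average over i of these
   matrices is the identity, they are bounded above by n%:R, so that the real
   supremum is a genuine one. *)
Definition dissimilarity (R : realType) (p n : nat) (nu : R)
    (f : 'I_n -> 'cV[R]_p -> R) (C : set 'cV[R]_p) : R :=
  sup [set (\big[Num.max/0]_(i < n)
              lambda1 (inv_sqrtmx (hessian (average f) w + nu%:M)
                       *m (hessian (f i) w + nu%:M)
                       *m inv_sqrtmx (hessian (average f) w + nu%:M)))
      | w in C].

Definition local_nbhd (R : realType) (p : nat) (F : 'cV[R]_p -> R)
    (nu M eps0 : R) (wstar : 'cV[R]_p) : set 'cV[R]_p :=
  [set w | wnorm (hessian F wstar) (w - wstar)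
           <= eps0 * nu `^ (3 / 2) / (2 * M)].

(** ** SketchySVRG *)

Definition minibatch_gradient (R : realType) (p n : nat) (nu : R)
    (f : 'I_n -> 'cV[R]_p -> R) (bg : nat) (B : {set 'I_n})
    (w : 'cV[R]_p) : 'cV[R]_p :=
  bg%:R^-1 *: (\sum_(i in B) gradient (f i) w) + nu *: w.

(* [precond t w] is the preconditioner which the algorithm constructs if it
   updates at global inner-iteration counter t, when the iterate is w.
   The state is the pair (iterate, current preconditioner). *)
Definition svrg_step (R : realType) (p n : nat) (nu : R)
    (f : 'I_n -> 'cV[R]_p -> R) (bg : nat) (U : pred nat)
    (precond : nat -> 'cV[R]_p -> 'M[R]_p) (eta : R)
    (what : 'cV[R]_p) (t : nat) (B : {set 'I_n})
    (st : 'cV[R]_p * 'M[R]_p) : 'cV[R]_p * 'M[R]_p :=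
  let P := if U t then precond t st.1 else st.2 in
  let v := minibatch_gradient nu f bg B st.1
           - minibatch_gradient nu f bg B what
           + gradient (objective nu f) what in
  (st.1 - eta *: (invmx P *m v), P).

(* State after k inner iterations of an outer iteration whose snapshot is [what]
   and whose first global counter is [t0]; [Bs t] is the minibatch at
   counter t. *)
Fixpoint svrg_inner (R : realType) (p n : nat) (nu : R)
    (f : 'I_n -> 'cV[R]_p -> R) (bg : nat) (U : pred nat)
    (precond : nat -> 'cV[R]_p -> 'M[R]_p) (eta : R)
    (Bs : nat -> {set 'I_n}) (what : 'cV[R]_p) (t0 : nat) (P : 'M[R]_p)
    (k : nat) {struct k} : 'cV[R]_p * 'M[R]_p :=
  if k is k'.+1 then
    svrg_step nu f bg U precond eta what (t0 + k') (Bs (t0 + k')%N)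
      (svrg_inner nu f bg U precond eta Bs what t0 P k')
  else (what, P).

(* State after s outer iterations (Option I) of m inner iterations each.  The
   initial matrix 0 is a placeholder, never used when 0 is an update time. *)
Fixpoint svrg_outer (R : realType) (p n : nat) (nu : R)
    (f : 'I_n -> 'cV[R]_p -> R) (bg : nat) (U : pred nat)
    (precond : nat -> 'cV[R]_p -> 'M[R]_p) (eta : R) (m : nat)
    (Bs : nat -> {set 'I_n}) (w0 : 'cV[R]_p) (s : nat) {struct s} :
    'cV[R]_p * 'M[R]_p :=
  if s is s'.+1 then
    let st := svrg_outer nu f bg U precond eta m Bs w0 s' in
    svrg_inner nu f bg U precond eta Bs st.1 (m * s') st.2 m
  else (w0, 0).

Definition sketchy_svrg (R : realType) (p n : nat) (nu : R)
    (f : 'I_n -> 'cV[R]_p -> R) (bg : nat) (U : pred nat)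
    (precond : nat -> 'cV[R]_p -> 'M[R]_p) (eta : R) (m : nat)
    (Bs : nat -> {set 'I_n}) (w0 : 'cV[R]_p) (s : nat) : 'cV[R]_p :=
  (svrg_outer nu f bg U precond eta m Bs w0 s).1.

Definition svrg_queries (n bg m s : nat) : nat := (s * (n + m * bg))%N.

(* All sequences of T minibatches of size bg; the uniform law on this set makes
   the minibatches independent, each uniform without replacement. *)
Definition minibatch_runs (n bg T : nat) : {set T.-tuple {set 'I_n}} :=
  [set om : T.-tuple {set 'I_n} | all (fun B : {set 'I_n} => #|B| == bg) om]%SET.

Definition finite_uniform_prob (R : realType) (T : finType) (A : {set T})
    (E : pred T) : R :=
  #|[set x in A | E x]%SET|%:R / #|A|%:R.

(* Batchsize order tau log(1/delta) up to the hidden logarithmic factor.  The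
   latter comes from the union bound over the O(log(1/eps)) iterations; the
   additive 1's keep the order bounded away from 0 as delta, eps tend to 1. *)
Definition batch_order (R : realType) (tau delta eps : R) : R :=
  tau * (1 + ln delta^-1) * (1 + ln (1 + ln eps^-1)).

(* Main.v *)
Require Import Defs.
From HB Require Import structures.
From mathcomp Require Import all_boot all_order all_algebra.
From mathcomp Require Import all_classical all_reals all_analysis.
From mathcomp Require Import spectral complex ring lra.

Set Implicit Arguments.
Unset Strict Implicit.
Unset Printing Implicit Defensive.

Import Order.TTheory GRing.Theory Num.Theory.
Import numFieldNormedType.Exports.

Local Open Scope classical_set_scope.
Local Open Scope ring_scope.

(** Each [F_i] has an [M]-Lipschitz Hessian bounded below by [nu], so on [N] the
    Hessians of all [F_i] and of [F] stay within a factor [1 +- 1/12] of their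
    values at the minimizer, and [P] is spectrally close to every one of the
    Hessians of [F] there.  A preconditioned full-gradient step therefore
    contracts the [P]-distance to the minimizer by [0.379].  The vectors
    [P^-1 (grad F_i w - grad F_i what)] have [P]-norm [O(tau D)] and mean square
    [O(tau D^2)], where [D = |w - what|_P].  The norm of their sum over a random
    minibatch is a Lipschitz function of the draws; bounding the exponential
    moment of its Doob martingale gives a Bernstein inequality without any
    dependence on the dimension, so a minibatch of order [tau log (s / delta)]
    produces noise at most [D / 100] outside an event of probability
    [delta / (6 s)].  A union bound over the [6 s] steps, each conditioned on its
    past, leaves with probability [1 - delta] a run in which every inner step
    brings the iterate within [2/5] of the distance of the snapshot, and [s]
    outer iterations divide the gap by at least [3 ^ s >= exp s >= eps ^ -2].
    When [bound >= n] the full batch is used and there is no noise. *)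

(** There is a circularity to break: the noise bound is available only for iterates inside [N],
    while staying inside [N] relies on small noise. A draw is therefore declared good by decree
    whenever its past has left [N]. The failure bound then holds for every past, and an induction
    along the run establishes membership before it invokes the noise bound.

    Two norms compete: [N] is a ball for the Hessian at the minimizer, while steps contract in the
    [P]-norm. The factor [2 / 5] is small enough to pay for the change of norm.

    The first power of [tau] in the variance is essential for the batch size. It appears because one
    of the two component Hessians produced by Cauchy-Schwarz is kept until the sum over [i] turns it
    into the Hessian of [F].

    Gradients are vector valued, so each mean value theorem is tested against one direction. Only
    Hessians at single points occur, and no integral of Hessians. *)

Definition bform (R : realType) (p : nat) (A : 'M[R]_p) (x y : 'cV[R]_p) : R :=
  (x^T *m A *m y) 0 0.

(** * Bilinear forms, weighted norms and Cauchy-Schwarz inequalities *)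

Section BilinearForms.
Context {R : realType} {p : nat}.
Implicit Types (A B P : 'M[R]_p) (x y z u v : 'cV[R]_p) (c : R).

Lemma qformE A x : qform A x = bform A x x. Proof. by []. Qed.

Lemma bformDl A x y z : bform A (x + y) z = bform A x z + bform A y z.
Proof. by rewrite /bform linearD /= !mulmxDl mxE. Qed.

Lemma bformDr A x y z : bform A z (x + y) = bform A z x + bform A z y.
Proof. by rewrite /bform mulmxDr mxE. Qed.

Lemma bformZl A c x y : bform A (c *: x) y = c * bform A x y.
Proof. by rewrite /bform linearZ /= -!scalemxAl mxE. Qed.

Lemma bformZr A c x y : bform A x (c *: y) = c * bform A x y.
Proof. by rewrite /bform -scalemxAr mxE. Qed.

Lemma bformNl A x y : bform A (- x) y = - bform A x y.
Proof. by rewrite -scaleN1r bformZl mulN1r. Qed.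

Lemma bformNr A x y : bform A x (- y) = - bform A x y.
Proof. by rewrite -scaleN1r bformZr mulN1r. Qed.

Lemma bform0r A x : bform A x 0 = 0.
Proof. by rewrite /bform mulmx0 mxE. Qed.

Lemma bform0l A x : bform A 0 x = 0.
Proof. by rewrite /bform trmx0 !mul0mx mxE. Qed.

Lemma bform_sumr A I (r : seq I) (Q : pred I) (X : I -> 'cV[R]_p) x :
  bform A x (\sum_(i <- r | Q i) X i) = \sum_(i <- r | Q i) bform A x (X i).
Proof. by rewrite /bform mulmx_sumr summxE. Qed.

Lemma bform_suml A I (r : seq I) (Q : pred I) (X : I -> 'cV[R]_p) x :
  bform A (\sum_(i <- r | Q i) X i) x = \sum_(i <- r | Q i) bform A (X i) x.
Proof. by rewrite /bform linear_sum /= !mulmx_suml summxE. Qed.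

Lemma bform_mxD A B x y : bform (A + B) x y = bform A x y + bform B x y.
Proof. by rewrite /bform mulmxDr mulmxDl mxE. Qed.

Lemma bform_mxZ A c x y : bform (c *: A) x y = c * bform A x y.
Proof. by rewrite /bform -scalemxAr -scalemxAl mxE. Qed.

Lemma bform_mxB A B x y : bform (A - B) x y = bform A x y - bform B x y.
Proof. by rewrite bform_mxD -scaleN1r bform_mxZ mulN1r. Qed.

Lemma bform_mx_sum I (r : seq I) (Q : pred I) (A : I -> 'M[R]_p) x y :
  bform (\sum_(i <- r | Q i) A i) x y = \sum_(i <- r | Q i) bform (A i) x y.
Proof. by rewrite /bform mulmx_sumr mulmx_suml summxE. Qed.

Lemma bform_mulmx A B x y : bform A x (B *m y) = bform (A *m B) x y.
Proof. by rewrite /bform !mulmxA. Qed.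

Lemma bform_scalar c x y : bform c%:M x y = c * bform 1%:M x y.
Proof. by rewrite -[c%:M]scalemx1 bform_mxZ. Qed.

Lemma bformC A x y : A^T = A -> bform A x y = bform A y x.
Proof.
move=> As; transitivity ((x^T *m A *m y)^T 0 0); first by rewrite [RHS]mxE.
by rewrite !trmx_mul trmxK As mulmxA.
Qed.

Lemma bform1E x y : bform 1%:M x y = \sum_i x i 0 * y i 0.
Proof. by rewrite /bform mulmx1 mxE; apply: eq_bigr => i _; rewrite mxE. Qed.

Lemma qform1_ge0 x : 0 <= qform 1%:M x.
Proof. by rewrite qformE bform1E sumr_ge0 // => i _; rewrite -expr2 sqr_ge0. Qed.

Lemma qform1_eq0 x : qform 1%:M x = 0 -> x = 0.
Proof.
rewrite qformE bform1E => /eqP.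
rewrite psumr_eq0 => [/allP x0|i _]; last by rewrite -expr2 sqr_ge0.
apply/colP => i; rewrite mxE; have := x0 i (mem_index_enum i).
by rewrite /= -expr2 sqrf_eq0 => /eqP.
Qed.

Lemma psd1 : psd (1%:M : 'M[R]_p).
Proof. by split; [exact: trmx1 | exact: qform1_ge0]. Qed.

Lemma spd_psd A : spd A -> psd A.
Proof.
move=> [As A_gt0]; split=> // x; have [->|/A_gt0/ltW //] := eqVneq x 0.
by rewrite qformE bform0l.
Qed.

Lemma spd_unitmx A : spd A -> A \in unitmx.
Proof.
move=> [As A_gt0]; rewrite -unitmx_tr -row_free_unit -kermx_eq0.
apply/eqP/row_matrixP => i; rewrite row0; apply/eqP; apply: contraT => k0.
have kA : row i (kermx A^T) *m A^T = 0.
  by rewrite -row_mul mulmx_ker row0.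
have tk0 : (row i (kermx A^T))^T != 0 by rewrite -trmx0 (inj_eq trmx_inj).
have := A_gt0 _ tk0.
by rewrite /qform trmxK As in kA *; rewrite kA mul0mx mxE ltxx.
Qed.

Lemma qformD A x y : A^T = A ->
  qform A (x + y) = qform A x + 2 * bform A x y + qform A y.
Proof.
by move=> As; rewrite !qformE !bformDl !bformDr (bformC y x As); ring.
Qed.

Lemma qformZ A c x : qform A (c *: x) = c ^+ 2 * qform A x.
Proof. by rewrite !qformE bformZl bformZr; ring. Qed.

Lemma qformN A x : qform A (- x) = qform A x.
Proof. by rewrite !qformE bformNl bformNr opprK. Qed.

Lemma psd_CS A x y : psd A -> bform A x y ^+ 2 <= qform A x * qform A y.
Proof.
move=> [As A0].
have key t : 0 <= qform A x + 2 * t * bform A x y + t ^+ 2 * qform A y.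
  have := A0 (x + t *: y); rewrite qformD // qformZ bformZr.
  by rewrite mulrA.
have qx := A0 x; have qy := A0 y; set b := bform _ _ _ in key *.
have [y0|yN0] := eqVneq (qform A y) 0.
  suff -> : b = 0 by rewrite expr0n /= mulr_ge0.
  apply/eqP; apply: contraT => b0.
  (* With [qform A y = 0] the polynomial in [t] is affine, and this [t] gives it the value -1. *)
  have := key (- (qform A x + 1) / (2 * b)).
  rewrite y0 mulr0 addr0.
  have -> : 2 * (- (qform A x + 1) / (2 * b)) * b = - (qform A x + 1).
    by field.
  by lra.
have y_gt0 : 0 < qform A y by rewrite lt_def yN0.
have := key (- b / qform A y).
have -> : qform A x + 2 * (- b / qform A y) * b +
   (- b / qform A y) ^+ 2 * qform A y = qform A x - b ^+ 2 / qform A y.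
  by field.
by rewrite subr_ge0 ler_pdivrMr.
Qed.

Lemma wnorm_ge0 A x : 0 <= wnorm A x. Proof. exact: sqrtr_ge0. Qed.

Lemma sqr_wnorm A x : psd A -> wnorm A x ^+ 2 = qform A x.
Proof. by move=> [_ A0]; rewrite sqr_sqrtr. Qed.

Lemma psd_CS_wnorm A x y : psd A -> `|bform A x y| <= wnorm A x * wnorm A y.
Proof.
move=> Ap; rewrite -ler_sqr ?nnegrE ?mulr_ge0 ?wnorm_ge0 //.
by rewrite real_normK ?num_real // exprMn !sqr_wnorm // psd_CS.
Qed.

Lemma wnormD A x y : psd A -> wnorm A (x + y) <= wnorm A x + wnorm A y.
Proof.
move=> Ap; rewrite -ler_sqr ?nnegrE ?addr_ge0 ?wnorm_ge0 //.
rewrite sqr_wnorm // qformD ?(proj1 Ap) // -!sqr_wnorm // sqrrD mulr2n.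
by have := le_trans (ler_norm _) (psd_CS_wnorm x y Ap); lra.
Qed.

Lemma wnormZ A c x : wnorm A (c *: x) = `|c| * wnorm A x.
Proof. by rewrite /wnorm qformZ sqrtrM ?sqr_ge0 // sqrtr_sqr. Qed.

Lemma wnormN A x : wnorm A (- x) = wnorm A x.
Proof. by rewrite /wnorm qformN. Qed.

Lemma wnorm0 A : wnorm A 0 = 0.
Proof. by rewrite /wnorm qformE bform0l sqrtr0. Qed.

Lemma wnormB_le A x y : psd A -> wnorm A x - wnorm A y <= wnorm A (x - y).
Proof. by move=> Ap; rewrite lerBlDr -{1}(subrK y x) wnormD. Qed.

Lemma wnorm_le A B c x y : 0 <= c -> qform A x <= c ^+ 2 * qform B y ->
  wnorm A x <= c * wnorm B y.
Proof.
move=> c0 AB.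
rewrite /wnorm -[leRHS](_ : Num.sqrt (c ^+ 2 * qform B y) = _) ?ler_wsqrtr //.
by rewrite sqrtrM ?sqr_ge0 // sqrtr_sqr ger0_norm.
Qed.

(** An operator norm bound in the geometry of [P], obtained without diagonalizing. The hypothesis
    makes [c *: P + A] and [c *: P - A] both positive semidefinite; Cauchy-Schwarz holds for each,
    and [A] and [c *: P] are their half difference and half sum. *)
Lemma bform_le_wnorm A P c x y : A^T = A -> psd P -> 0 <= c ->
  (forall z, `|qform A z| <= c * qform P z) ->
  `|bform A x y| <= c * wnorm P x * wnorm P y.
Proof.
move=> As [Ps P0] c0 AP.
have psdp : psd (c *: P + A).
  split=> [|z]; first by rewrite linearD linearZ /= As Ps.
  have := AP z; rewrite !qformE bform_mxD bform_mxZ ler_norml.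
  by move=> /andP[? _]; lra.
have psdm : psd (c *: P - A).
  split=> [|z]; first by rewrite linearB linearZ /= As Ps.
  have := AP z; rewrite !qformE bform_mxB bform_mxZ ler_norml.
  by move=> /andP[_ ?]; lra.
have cp := psd_CS x y psdp; have cm := psd_CS x y psdm.
rewrite -ler_sqr ?nnegrE ?mulr_ge0 ?wnorm_ge0 //.
rewrite real_normK ?num_real // !exprMn !sqr_wnorm; [|by split..].
have ap := proj2 psdp x; have bp := proj2 psdp y.
have am := proj2 psdm x; have bm := proj2 psdm y.
have ex : 2 * (c * qform P x) = qform (c *: P + A) x + qform (c *: P - A) x.
  by rewrite !qformE bform_mxD bform_mxB bform_mxZ; ring.
have ey : 2 * (c * qform P y) = qform (c *: P + A) y + qform (c *: P - A) y.
  by rewrite !qformE bform_mxD bform_mxB bform_mxZ; ring.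
have eb : 2 * bform A x y = bform (c *: P + A) x y - bform (c *: P - A) x y.
  by rewrite bform_mxD bform_mxB; ring.
have -> : c ^+ 2 * qform P x * qform P y = (c * qform P x) * (c * qform P y).
  by ring.
rewrite -(ler_pM2l (_ : 0 < 4 :> R)) //.
have -> : 4 * bform A x y ^+ 2 = (2 * bform A x y) ^+ 2 by ring.
have -> : 4 * (c * qform P x * (c * qform P y)) =
  (2 * (c * qform P x)) * (2 * (c * qform P y)) by ring.
rewrite ex ey eb.
set a := qform _ x in cp ap *; set b := qform _ y in cp bp *.
set d := qform _ x in cm am *; set e := qform _ y in cm bm *.
set s := bform _ x y in cp *; set t := bform _ x y in cm *.
(* the cross terms: [2 |s t| <= 2 sqrt (a b d e) <= a e + b d] *)
have : (2 * (s * t)) ^+ 2 <= (a * e + d * b) ^+ 2.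
  have -> : (a * e + d * b) ^+ 2 =
    (a * e - d * b) ^+ 2 + 4 * (a * b * (d * e)) by ring.
  have -> : (2 * (s * t)) ^+ 2 = 4 * (s ^+ 2 * t ^+ 2) by ring.
  have : s ^+ 2 * t ^+ 2 <= a * b * (d * e) by rewrite ler_pM ?sqr_ge0.
  have := sqr_ge0 (a * e - d * b).
  by lra.
have r0 : 0 <= a * e + d * b by rewrite addr_ge0 ?mulr_ge0.
by nra.
Qed.

Lemma sqr_norm2 x : norm2 x ^+ 2 = qform 1%:M x.
Proof. exact: (sqr_wnorm x psd1). Qed.

Lemma scale_norm2_le A c x : 0 <= c -> c * qform 1%:M x <= qform A x ->
  Num.sqrt c * norm2 x <= wnorm A x.
Proof. by move=> c0 cA; rewrite /norm2 /wnorm -sqrtrM // ler_wsqrtr. Qed.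

Lemma bform1_mulmx A x y : bform 1%:M x (A *m y) = bform A x y.
Proof. by rewrite bform_mulmx mul1mx. Qed.

Lemma qform_mxB A B x : qform (A - B) x = qform A x - qform B x.
Proof. exact: bform_mxB. Qed.

End BilinearForms.

(** * Spectral theory of real symmetric matrices through complex diagonalization *)

Lemma interpolation (F : fieldType) (s : seq F) (g : F -> F) : uniq s ->
  exists q : {poly F}, {in s, forall x, q.[x] = g x}.
Proof.
elim: s => [|a s IHs] /=; first by exists 0.
move=> /andP[ans /IHs [q qE]].
pose r := \prod_(x <- s) ('X - x%:P).
have r_a : r.[a] != 0.
  by rewrite -/(root r a) root_prod_XsubC.
exists (q + ((g a - q.[a]) / r.[a]) *: r) => x.
rewrite inE hornerD hornerZ => /orP[/eqP ->|xs]; first by rewrite divfK // subrKC.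
have /eqP -> : root r x by rewrite root_prod_XsubC.
by rewrite mulr0 addr0 qE.
Qed.

Section DiagonalizationOverExtension.
Context {K F : fieldType} {p : nat} (phi : {rmorphism K -> F}).
Variable U : 'M[F]_p.+1.
Hypothesis U_unit : U \in unitmx.

(** Only the basis [U] uses the larger field: [e] lies in [K], so polynomials over [K] act on [B]
    and on [e] alike. *)
Definition diagonalized (B : 'M[K]_p.+1) (e : 'rV[K]_p.+1) :=
  map_mx phi B = invmx U *m diag_mx (map_mx phi e) *m U.

Lemma diagonalized_eigenvalue B e : diagonalized B e ->
  forall a, eigenvalue B a <-> exists j, a = e 0 j.
Proof.
rewrite /diagonalized => BE a; rewrite -(eigenvalue_map phi) BE; split.
  move=> /eigenvalueP[v vE v0].
  have w0 : v *m invmx U != 0 by rewrite mulmx_free_eq0 // row_free_unit unitmx_inv.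
  have [j wj] : exists j, (v *m invmx U) 0 j != 0.
    by apply/existsP; apply: contraNT w0; rewrite negb_exists => /forallP w0;
      apply/eqP/rowP => j; have := w0 j; rewrite negbK => /eqP ->; rewrite mxE.
  exists j; have /rowP/(_ j) : v *m invmx U *m diag_mx (map_mx phi e)
      = phi a *: (v *m invmx U).
    by rewrite scalemxAl -vE !mulmxA -[RHS]mulmxA mulmxV // mulmx1.
  move: (v *m invmx U) wj => w wj.
  by rewrite mul_mx_diag !mxE mulrC => /(mulIf wj) /fmorph_inj.
move=> [j ->]; apply/eigenvalueP; exists (delta_mx 0 j *m U).
  rewrite !mulmxA -[delta_mx _ _ *m _ *m _]mulmxA mulmxV // mulmx1.
  rewrite mul_mx_diag scalemxAl; congr (_ *m _).
  apply/rowP => k; rewrite !mxE /=; case: (j =P k) => [->|/eqP jk].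
    by rewrite mulrC.
  by rewrite (negbTE (_ : k != j)) 1?eq_sym // mul0r mulr0.
rewrite mulmx_free_eq0 ?row_free_unit //.
by apply/eqP => /rowP/(_ j); rewrite !mxE !eqxx => /eqP; rewrite oner_eq0.
Qed.

Lemma diagonalized_horner B e (q : {poly K}) : diagonalized B e ->
  diagonalized (horner_mx B q) (map_mx (horner q) e).
Proof.
rewrite /diagonalized => BE.
rewrite map_horner_mx BE horner_mx_uconjC // horner_mx_diag.
congr (_ *m diag_mx _ *m _); apply/rowP => j.
by rewrite !mxE horner_map.
Qed.

Lemma diagonalized_mul A B d e : diagonalized A d -> diagonalized B e ->
  diagonalized (A *m B) (\row_j (d 0 j * e 0 j)).
Proof.
rewrite /diagonalized => AE BE.
rewrite map_mxM AE BE !mulmxA -[_ *m U *m invmx U]mulmxA mulmxV // mulmx1.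
rewrite -[_ *m diag_mx _ *m diag_mx _]mulmxA mulmx_diag.
congr (_ *m diag_mx _ *m _).
by apply/rowP => j; rewrite !mxE -rmorphM.
Qed.

Lemma diagonalized_inj A B d : diagonalized A d -> diagonalized B d -> A = B.
Proof. by move=> AE BE; apply: (map_mx_inj (f := phi)); rewrite AE BE. Qed.

End DiagonalizationOverExtension.

Lemma trmx_horner_mx (F : fieldType) (p : nat) (A : 'M[F]_p.+1) (q : {poly F}) :
  A^T = A -> (horner_mx A q)^T = horner_mx A q.
Proof.
move=> As; elim/poly_ind: q => [|q c IHq]; first by rewrite rmorph0 trmx0.
rewrite rmorphD rmorphM /= horner_mx_X horner_mx_C linearD /= tr_scalar_mx.
rewrite [(_ * _)^T]trmx_mul IHq As; congr (_ + _).
exact/comm_mx_horner.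
Qed.

(** Over [C] the matrix is Hermitian, so its spectrum is real there and [re] brings it back to
    [K]. *)
Lemma symmetric_diagonalized (K : fieldType) (C : numClosedFieldType)
    (phi : {rmorphism K -> C}) (re : C -> K) (p : nat) (A : 'M[K]_p.+1) :
  (forall x, phi x \is Num.real) -> {in Num.real, cancel re phi} -> A^T = A ->
  exists U d, U \in unitmx /\ diagonalized phi U A d.
Proof.
move=> phi_real reK As; pose B := map_mx phi A.
have Bherm : B \is hermsymmx.
  apply: realsym_hermsym; last by apply/mxOverP => i j; rewrite mxE.
  by apply/is_hermitianmxP; rewrite expr0 scale1r map_mx_id // /B map_trmx As.
have /hermitian_normalmx /orthomx_spectralP BE := Bherm.
exists (spectralmx B), (map_mx re (spectral_diag B)); split; first exact: spectral_unit.
rewrite /diagonalized -/B {1}BE; congr (_ *m diag_mx _ *m _).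
apply/rowP => j; rewrite !mxE reK //.
exact: (mxOverP (hermitian_spectral_diag_real Bherm)).
Qed.

Section SpectralConsequences.
Context {R : realType}.

(* The square root is a real polynomial in A, hence symmetric. *)
Lemma symmetric_sqrt (p : nat) (A : 'M[R]_p) : A^T = A ->
  (forall a, eigenvalue A a -> 0 <= a) ->
  exists T : 'M[R]_p, [/\ T^T = T, T *m T = A &
    forall a, eigenvalue T a -> 0 <= a].
Proof.
case: p A => [|p] A As A0.
  exists 0; split; [exact: trmx0 | by rewrite (flatmx0 A) (flatmx0 (0 *m 0)) |].
  by move=> a /eigenvalueP[v _]; rewrite (thinmx0 v) eqxx.
have cR (x : R) : real_complex R x \is Num.real by apply/complex_realP; exists x.
have ReK : {in Num.real, cancel (@complex.Re R) (real_complex R)} by exact: RRe_real.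
have [U [d [Uu AE]]] := symmetric_diagonalized cR ReK As.
have d0 j : 0 <= d 0 j by apply/A0/(diagonalized_eigenvalue Uu AE); exists j.
have [q qE] := @interpolation R (undup [seq d 0 j | j : 'I_p.+1]) Num.sqrt (undup_uniq _).
have {}qE j : q.[d 0 j] = Num.sqrt (d 0 j).
  by apply: qE; rewrite mem_undup; apply/mapP; exists j => //; rewrite mem_enum.
have TE := diagonalized_horner Uu q AE.
exists (horner_mx A q); split; first exact: trmx_horner_mx.
- apply: diagonalized_inj (diagonalized_mul Uu TE TE) _.
  rewrite (_ : \row_j _ = d) //; apply/rowP => j.
  by rewrite !mxE qE -expr2 sqr_sqrtr.
- by move=> a /(diagonalized_eigenvalue Uu TE)[j ->]; rewrite mxE qE sqrtr_ge0.
Qed.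

(** With a symmetric square root [T] of [A], the form [qform A x] is the squared Euclidean norm of
    [T *m x]. This converts knowledge of the spectrum into a Loewner inequality. *)
Lemma symmetric_psd (p : nat) (A : 'M[R]_p) : A^T = A ->
  (forall a, eigenvalue A a -> 0 <= a) -> psd A.
Proof.
move=> As A0; split=> // x; have [T [Ts TT _]] := symmetric_sqrt As A0.
have -> : qform A x = qform 1%:M (T *m x).
  by rewrite /qform trmx_mul Ts mulmx1 -TT !mulmxA.
exact: qform1_ge0.
Qed.

Lemma eigenvalue_qform (p : nat) (A : 'M[R]_p) a : A^T = A -> eigenvalue A a ->
  exists2 x : 'cV[R]_p, x != 0 & qform A x = a * qform 1%:M x.
Proof.
move=> As /eigenvalueP[v vA v0]; exists v^T.
  by rewrite -trmx0 (inj_eq trmx_inj).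
by rewrite /qform trmxK vA mulmx1 -scalemxAl mxE.
Qed.

Lemma qform1_gt0 (p : nat) (x : 'cV[R]_p) : x != 0 -> 0 < qform 1%:M x.
Proof.
by move=> x0; rewrite lt_def qform1_ge0 andbT; apply: contraNneq x0 => /qform1_eq0 ->.
Qed.

(** [inv_sqrtmx] is chosen by [get], so one witness suffices: the square root [T] of the inverse.
    Definiteness of [T] comes from its own square root [S], since [S *m x = 0] would force
    [invmx A *m x = 0]. *)
Lemma inv_sqrtmx_spec (p : nat) (A : 'M[R]_p) : spd A ->
  spd (inv_sqrtmx A) /\ inv_sqrtmx A *m inv_sqrtmx A = invmx A.
Proof.
move=> Aspd; have Au := spd_unitmx Aspd; have [As A0] := Aspd.
have Is : (invmx A)^T = invmx A by rewrite trmx_inv As.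
have I0 a : eigenvalue (invmx A) a -> 0 <= a.
  move=> /(eigenvalue_qform Is)[x x0 /eqP].
  have -> : qform (invmx A) x = qform A (invmx A *m x).
    by rewrite /qform trmx_mul Is !mulmxA mulmxKV.
  move=> /eqP qE; have := proj2 (spd_psd Aspd) (invmx A *m x).
  by rewrite qE pmulr_lge0 // qform1_gt0.
have [T [Ts TT T0]] := symmetric_sqrt Is I0.
have [S [Ss SS _]] := symmetric_sqrt Ts T0.
suff : [set S : 'M[R]_p | spd S /\ S *m S = invmx A] T by move/getI.
split=> //; split=> // x x0.
have -> : qform T x = qform 1%:M (S *m x).
  by rewrite /qform trmx_mul Ss mulmx1 -SS !mulmxA.
apply: qform1_gt0; apply: contra_neq x0 => Sx0.
have : invmx A *m x = 0 by rewrite -TT -SS -!mulmxA Sx0 !mulmx0.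
by move/(congr1 (mulmx A)); rewrite mulmx0 mulKVmx.
Qed.

(* [lambda1 B - B] has nonnegative spectrum. *)
Lemma qform_le_lambda1 (p : nat) (B : 'M[R]_p) (c : R) (x : 'cV[R]_p) : B^T = B ->
  (forall y, qform B y <= c * qform 1%:M y) ->
  qform B x <= lambda1 B * qform 1%:M x.
Proof.
move=> Bs Bc; have ub a : eigenvalue B a -> a <= c.
  move=> /(eigenvalue_qform Bs)[y y0 yE].
  by have := Bc y; rewrite yE ler_pM2r // qform1_gt0.
rewrite -subr_ge0; set l := lambda1 B.
have -> : l * qform 1%:M x - qform B x = qform (l%:M - B) x.
  by rewrite !qformE bform_mxB (bform_scalar l).
apply: (proj2 (symmetric_psd _ _)) => [|a].
  by rewrite linearB /= tr_scalar_mx Bs.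
move=> /eigenvalueP[v vE v0].
have la : eigenvalue B (l - a).
  apply/eigenvalueP; exists v => //; move: vE.
  rewrite mulmxBr mul_mx_scalar scalerBl => <-.
  by rewrite opprB addrC subrK.
have : l - a <= l by apply: ub_le_sup => //; exists c => b /ub.
by rewrite lerBlDr lerDl.
Qed.

Lemma lambda1_le (p : nat) (B : 'M[R]_p) (c : R) : B^T = B -> 0 <= c ->
  (forall y, qform B y <= c * qform 1%:M y) -> lambda1 B <= c.
Proof.
move=> Bs c0 Bc; rewrite /lambda1.
(* An empty spectrum (as for [p = 0]) has supremum 0 by convention; this is where [0 <= c]
   enters. *)
have [->|ne] := eqVneq [set a : R | eigenvalue B a] set0; first by rewrite sup0.
apply: ge_sup; first exact/set0P.
move=> a /= /(eigenvalue_qform Bs)[y y0 yE].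
by have := Bc y; rewrite yE ler_pM2r // qform1_gt0.
Qed.

End SpectralConsequences.

(** * Derivatives along lines; symmetry and positivity of Hessians *)

Section LineDerivatives.
Context {R : realType}.

(** The difference quotients on both sides are the same function of the increment. *)
Lemma is_derive_line (p : nat) (h : 'cV[R]_p -> R) (x u : 'cV[R]_p) (t d : R) :
  is_derive (x + t *: u) u h d ->
  is_derive t 1 (fun s : R => h (x + s *: u)) d.
Proof.
move=> [dh dE].
have E : (fun s : R => s^-1 *: (((fun s : R => h (x + s *: u)) \o shift t) (s *: 1) -
    h (x + t *: u))) =
  (fun s : R => s^-1 *: ((h \o shift (x + t *: u)) (s *: u) - h (x + t *: u))).
  apply/funext => s /=; congr (_ *: (h _ - _)).
  by rewrite /shift /= [s *: 1]mulr1 scalerDl addrCA.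
by split; [rewrite /derivable E | rewrite /derive E].
Qed.

Lemma is_derive_coords (p : nat) (h : 'cV[R]_p -> R) (x u : 'cV[R]_p) :
  differentiable h x ->
  is_derive x u h (\sum_i u i 0 * 'D_(delta_mx i 0) h x).
Proof.
move=> dh; have H : derivable h x u := diff_derivable dh.
suff -> : \sum_i u i 0 * 'D_(delta_mx i 0) h x = 'D_u h x by exact: derivableP.
rewrite deriveE // {2}(matrix_sum_delta u) linear_sum.
by apply: eq_bigr => i _; rewrite big_ord1 linearZ deriveE.
Qed.

Lemma MVT_line (phi dphi : R -> R) (a b : R) : a < b ->
  (forall t, is_derive t (1 : R) phi (dphi t)) ->
  exists c, [/\ a < c, c < b & phi b - phi a = dphi c * (b - a)].
Proof.
move=> ab H.
have phi_cont : {within `[a, b], continuous phi}.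
  apply: continuous_subspaceT => t; apply: differentiable_continuous.
  by apply/derivable1_diffP; have [] := H t.
have [c cab E] := MVT ab (fun t _ => H t) phi_cont.
by move: cab; rewrite in_itv /= => /andP[? ?]; exists c.
Qed.

Lemma eq0_of_le_linear (a C : R) : (forall h, 0 < h -> `|a| <= h * C) -> a = 0.
Proof.
move=> aC; apply/eqP; rewrite -normr_eq0 eq_le normr_ge0 andbT.
apply/ler_addgt0Pr => e e0; rewrite add0r.
have C1 : 0 < `|C| + 1 by rewrite ltr_wpDl.
apply: (le_trans (aC _ (divr_gt0 e0 C1))).
rewrite mulrAC ler_pdivrMr // ler_pM2l //.
by have := ler_norm C; lra.
Qed.

End LineDerivatives.

Section SecondOrder.
Context {R : realType} {p : nat}.
Variable g : 'cV[R]_p -> R.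
Hypothesis g2 : twice_differentiable g.

Lemma is_derive_line_grad x u t :
  is_derive t (1 : R) (fun s : R => g (x + s *: u))
    (bform 1%:M u (gradient g (x + t *: u))).
Proof.
apply: is_derive_line; rewrite bform1E.
apply: is_derive_eq; first exact: (is_derive_coords _ (g2 _).1).
by apply: eq_bigr => i _; rewrite mxE.
Qed.

Lemma differentiable_gradient_coord x i :
  differentiable (fun y : 'cV[R]_p => gradient g y i 0) x.
Proof.
apply: (@differentiable_comp _ _ _ _ (gradient g) (fun z : 'cV[R]_p => z i 0)).
  exact: (g2 x).2.
exact: differentiable_coord.
Qed.

Lemma is_derive_line_hess x u v t :
  is_derive t (1 : R) (fun s : R => bform 1%:M v (gradient g (x + s *: u)))
    (bform (hessian g (x + t *: u)) v u).
Proof.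
have -> : (fun s : R => bform 1%:M v (gradient g (x + s *: u))) =
  \sum_i (fun s : R => v i 0 *: (fun s : R => gradient g (x + s *: u) i 0) s).
  by apply/funext => s; rewrite bform1E fct_sumE.
apply: is_derive_eq.
  apply: is_derive_sum => i; apply: is_deriveZ.
  apply: (is_derive_line (h := fun y => gradient g y i 0)).
  exact: (is_derive_coords _ (differentiable_gradient_coord _ _)).
rewrite /bform -mulmxA mxE; apply: eq_bigr => i _; rewrite mxE.
congr (_ * _); rewrite mxE; apply: eq_bigr => j _.
by rewrite !mxE mulrC.
Qed.

(** The intermediate point exists only once the gradient is tested against a fixed [u], and it
    depends on that [u]. *)
Lemma grad_MVT x y u : exists c : R, [/\ 0 <= c, c <= 1 &
  bform 1%:M u (gradient g y - gradient g x) =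
  bform (hessian g (x + c *: (y - x))) u (y - x)].
Proof.
have [c [c0 c1]] := MVT_line ltr01 (is_derive_line_hess x (y - x) u).
rewrite subr0 mulr1 scale1r scale0r addr0 subrKC => H.
by exists c; split; [exact: ltW | exact: ltW | rewrite bformDr bformNr].
Qed.

Variable M : R.
Hypothesis gM : lipschitz_hessian M g.

Lemma lipschitz_hessian_bform x y u v :
  `|bform (hessian g x - hessian g y) u v| <=
  M * norm2 (x - y) * norm2 u * norm2 v.
Proof.
have -> : bform (hessian g x - hessian g y) u v =
  bform 1%:M u ((hessian g x - hessian g y) *m v).
  by rewrite bform_mulmx mul1mx.
apply: le_trans (psd_CS_wnorm _ _ psd1) _.
rewrite [leRHS](_ : _ = norm2 u * (M * norm2 (x - y) * norm2 v)); last by ring.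
by apply: ler_wpM2l; [exact: wnorm_ge0 | exact: gM].
Qed.

(** Two mean value theorems: one along [u] for the increment of [g] in direction [v], then one along
    [v] for the [u]-component of the gradient. *)
Lemma second_difference x u v h : 0 < h ->
  exists c d, [/\ 0 < c < h, 0 < d < h &
    g (x + h *: u + h *: v) - g (x + h *: u) - g (x + h *: v) + g x =
    h * h * bform (hessian g (x + c *: u + d *: v)) u v].
Proof.
move=> h0.
have D t : is_derive t (1 : R) (fun s => g (x + h *: v + s *: u) - g (x + s *: u))
    (bform 1%:M u (gradient g (x + h *: v + t *: u)) -
     bform 1%:M u (gradient g (x + t *: u))).
  by apply: is_deriveB; exact: is_derive_line_grad.
have [c [c0 ch cE]] := MVT_line h0 D.
have [d [d0 dh dE]] := MVT_line h0 (is_derive_line_hess (x + c *: u) v u).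
exists c, d; split; [by rewrite c0 ch | by rewrite d0 dh |].
move: cE dE; rewrite !scale0r !addr0 !subr0 => cE dE.
rewrite -[x + h *: u + _]addrAC -mulrA [h * bform _ _ _]mulrC -dE.
by rewrite -[x + c *: u + _]addrAC mulrC -cE; ring.
Qed.

(** The second difference is symmetric in [u] and [v], so the two orders of expansion equate Hessian
    entries at two points within [O(h)] of [x]. The Lipschitz bound moves both to [x] at a cost
    linear in [h], which is arbitrary. *)
Lemma hessian_sym x : (hessian g x)^T = hessian g x.
Proof.
have key u v : bform (hessian g x) u v = bform (hessian g x) v u.
  apply/eqP; rewrite -subr_eq0; apply/eqP.
  pose C := 2 * `|M| * (norm2 u + norm2 v) * norm2 u * norm2 v.
  apply: (@eq0_of_le_linear _ _ C) => h h0.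
  have [c [d [/andP[c0 ch] /andP[d0 dh] E1]]] := second_difference x u v h0.
  have [c' [d' [/andP[c'0 c'h] /andP[d'0 d'h] E2]]] := second_difference x v u h0.
  have {E1 E2} E : bform (hessian g (x + c *: u + d *: v)) u v =
      bform (hessian g (x + c' *: v + d' *: u)) v u.
    apply: (mulfI (_ : h * h != 0)); first by rewrite mulf_neq0 ?gt_eqF.
    by rewrite -E1 -E2 [x + h *: v + _]addrAC; ring.
  have near a b z w : 0 < a < h -> 0 < b < h ->
    `|bform (hessian g (x + a *: z + b *: w)) z w - bform (hessian g x) z w| <=
    h * (`|M| * (norm2 z + norm2 w) * norm2 z * norm2 w).
    move=> /andP[a0 ah] /andP[b0 bh]; rewrite -bform_mxB.
    apply: le_trans (lipschitz_hessian_bform _ _ _ _) _.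
    rewrite !mulrA; apply: ler_wpM2r; first exact: wnorm_ge0.
    apply: ler_wpM2r; first exact: wnorm_ge0.
    have -> : x + a *: z + b *: w - x = a *: z + b *: w.
      by rewrite addrAC [x + _]addrC addrK.
    rewrite [h * _]mulrC -mulrA.
    apply: le_trans (ler_wpM2r (wnorm_ge0 _ _) (ler_norm M)) _.
    apply: ler_wpM2l => //; apply: le_trans (wnormD _ _ psd1) _.
    by rewrite !wnormZ !gtr0_norm // mulrDr lerD // ler_wpM2r ?wnorm_ge0 // ltW.
  have aux (b1 b2 s1 s2 K1 K2 : R) : b1 = b2 -> `|b1 - s1| <= K1 ->
      `|b2 - s2| <= K2 -> `|s1 - s2| <= K1 + K2.
    by move=> ->; rewrite distrC => n1 n2; have := ler_distD b2 s1 s2; lra.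
  apply: le_trans (aux _ _ _ _ _ _ E (near _ _ _ _ _ _) (near _ _ _ _ _ _)) _.
  - by rewrite c0 ch.
  - by rewrite d0 dh.
  - by rewrite c'0 c'h.
  - by rewrite d'0 d'h.
  by rewrite le_eqVlt; apply/orP; left; apply/eqP; rewrite /C; ring.
apply/matrixP => i j; rewrite mxE.
have := key (delta_mx i 0) (delta_mx j 0).
by rewrite /bform !trmx_delta -!rowE -!colE !mxE.
Qed.

(** Midpoint convexity makes the symmetric second difference at [x] nonnegative. Two mean value
    theorems express it as a positive multiple of the Hessian form at a point within [h] of [x], up
    to a Lipschitz error. *)
Lemma hessian_psd_of_convex x : convex_function [set: 'cV[R]_p] g ->
  psd (hessian g x).
Proof.
move=> gc; split; first exact: hessian_sym.
move=> u; apply/ler_addgt0Pr => e e0.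
pose C := `|M| * norm2 u ^+ 3.
have C0 : 0 <= C by rewrite mulr_ge0 // exprn_ge0 // wnorm_ge0.
(* Chosen so that the Lipschitz error [h * C] is at most [e]; the added 1 keeps the denominator
   positive. *)
pose h := e / (C + 1).
have h0 : 0 < h by rewrite divr_gt0 // ltr_wpDl.
have mid : 0 <= g (x + h *: u) + g (x + h *: - u) - (g x + g x).
  have half0 : 0 <= (2^-1 : R) by lra.
  have half1 : (2^-1 : R) <= 1 by lra.
  have := gc (Itv01 half0 half1) (x + h *: u) (x + h *: - u).
  rewrite !inE convRE /= => /(_ I I).
  set z := (X in g X <= _); have -> : z = x.
    have -> : z = 2^-1 *: (x + h *: u) + (1 - 2^-1) *: (x + h *: - u) by [].
    by apply/colP => i; rewrite !mxE; field.
  by rewrite /unstable.onem; lra.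
have D t : is_derive t (1 : R) (fun s => g (x + s *: u) + g (x + s *: - u))
    (bform 1%:M u (gradient g (x + t *: u)) +
     bform 1%:M (- u) (gradient g (x + t *: - u))).
  by apply: is_deriveD; exact: is_derive_line_grad.
have [c [c0 ch cE]] := MVT_line h0 D.
have Ncc : - c < c by lra.
have [d [d0 dh dE]] := MVT_line Ncc (is_derive_line_hess x u u).
have near : `|bform (hessian g (x + d *: u)) u u - bform (hessian g x) u u| <= h * C.
  rewrite -bform_mxB; apply: le_trans (lipschitz_hessian_bform _ _ _ _) _.
  rewrite [x + _]addrC addrK /norm2 wnormZ -/(norm2 u).
  have -> : h * C = `|M| * (h * norm2 u) * norm2 u * norm2 u.
    by rewrite /C; ring.
  do 2!(apply: ler_wpM2r; first exact: wnorm_ge0).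
  apply: le_trans (ler_wpM2r _ (ler_norm M)) _; first by rewrite mulr_ge0 ?wnorm_ge0.
  apply: ler_wpM2l => //; apply: ler_wpM2r; first exact: wnorm_ge0.
  by rewrite ler_norml; lra.
have hC : h * C <= e.
  by rewrite /h mulrAC ler_pdivrMr ?ltr_wpDl // ler_pM2l // lerDl.
have Hd : 0 <= bform (hessian g (x + d *: u)) u u.
  have eNc : c *: - u = - c *: u by rewrite scalerN scaleNr.
  rewrite eNc bformNl dE !scale0r !addr0 in cE.
  have c2 : 0 < (c - - c) * (h - 0) by rewrite mulr_gt0 // subr_gt0.
  by move: mid; rewrite cE -mulrA pmulr_lge0.
have aux (b1 b2 k : R) : `|b2 - b1| <= k -> k <= e -> 0 <= b2 -> 0 <= b1 + e.
  by rewrite ler_norml => /andP[_ ?] ? ?; lra.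
exact: aux near hC Hd.
Qed.

End SecondOrder.

(** * Gradients and Hessians of regularized and averaged functions *)

Section Constructions.
Context {R : realType} {p : nat}.
Implicit Types (g : 'cV[R]_p -> R) (nu : R).

Lemma is_derive_coord (x v : 'cV[R]_p) i :
  is_derive x v (fun w : 'cV[R]_p => w i 0) (v i 0).
Proof.
have C : h^-1 *: (((fun w : 'cV[R]_p => w i 0) \o shift x) (h *: v) - x i 0)
    @[h --> 0^'] --> (v i 0 : R).
  apply: cvg_near_cst; near=> h.
  rewrite /= !mxE addrK /GRing.scale /= mulKf //.
  by near: h; exact: nbhs_dnbhs_neq.
by split; [apply/cvg_ex; exists (v i 0) | exact: cvg_lim C].
Unshelve. all: by end_near. Qed.

Lemma half_sqnorm_derive nu x v :
  is_derive x v (fun w : 'cV[R]_p => nu / 2 * norm2 w ^+ 2) (nu * bform 1%:M v x).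
Proof.
have -> : (fun w : 'cV[R]_p => nu / 2 * norm2 w ^+ 2) =
    nu / 2 \*: (\sum_i (fun w : 'cV[R]_p => w i 0) * (fun w : 'cV[R]_p => w i 0)).
  apply/funext => w /=; rewrite (sqr_wnorm _ psd1) qformE bform1E.
  by rewrite [in RHS]fct_sumE.
apply: is_derive_eq.
  apply: is_deriveZ; apply: is_derive_sum => i.
  by apply: is_deriveM; exact: is_derive_coord.
rewrite bform1E !scaler_sumr mulr_sumr; apply: eq_bigr => i _.
by rewrite /GRing.scale /=; field.
Qed.

Lemma half_sqnorm_differentiable nu x :
  differentiable (fun w : 'cV[R]_p => nu / 2 * norm2 w ^+ 2) x.
Proof.
have -> : (fun w : 'cV[R]_p => nu / 2 * norm2 w ^+ 2) =
    nu / 2 \*: (\sum_i (fun w : 'cV[R]_p => w i 0) * (fun w : 'cV[R]_p => w i 0)).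
  apply/funext => w /=; rewrite (sqr_wnorm _ psd1) qformE bform1E.
  by rewrite [in RHS]fct_sumE.
apply: differentiableZ; apply: differentiable_sum => i.
by apply: differentiableM; exact: differentiable_coord.
Qed.

End Constructions.

Section Regularization.
Context {R : realType} {p : nat}.
Implicit Types (g : 'cV[R]_p -> R) (nu : R).

Lemma gradient_regularized nu g x : twice_differentiable g ->
  gradient (regularized nu g) x = gradient g x + nu *: x.
Proof.
move=> g2; apply/colP => i; rewrite !mxE; apply: derive_val.
have -> : x i 0 = bform 1%:M (delta_mx i 0) x.
  by rewrite /bform trmx_delta mulmx1 -rowE !mxE.
apply: is_deriveD; last exact: half_sqnorm_derive.
exact/derivableP/diff_derivable/(g2 x).1.
Qed.

Lemma hessian_regularized nu g x : twice_differentiable g ->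
  hessian (regularized nu g) x = hessian g x + nu%:M.
Proof.
move=> g2; apply/matrixP => i j; rewrite !mxE.
have -> : (fun y : 'cV[R]_p => gradient (regularized nu g) y i 0) =
    (fun y => gradient g y i 0) + nu \*: (fun y : 'cV[R]_p => y i 0).
  by apply/funext => y; rewrite gradient_regularized // mxE; congr (_ + _); exact: mxE.
apply: derive_val; apply: is_derive_eq.
  apply: is_deriveD.
    exact/derivableP/diff_derivable/(differentiable_gradient_coord _).
  by apply: is_deriveZ; exact: is_derive_coord.
by congr (_ + _); rewrite !mxE eqxx andbT /GRing.scale /= mulr_natr.
Qed.

Lemma gradient_differentiable g x :
  (forall i, differentiable (fun y : 'cV[R]_p => gradient g y i 0) x) ->
  differentiable (gradient g) x.
Proof.
move=> H.
have -> : gradient g =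
    \sum_i (fun y : 'cV[R]_p => gradient g y i 0 *: (delta_mx i 0 : 'cV[R]_p)).
  apply/funext => y; rewrite fct_sumE [LHS]matrix_sum_delta.
  by apply: eq_bigr => i _; rewrite big_ord1.
apply: differentiable_sum => i.
exact: differentiableZl.
Qed.

Lemma twice_differentiable_regularized nu g : twice_differentiable g ->
  twice_differentiable (regularized nu g).
Proof.
move=> g2 x; split.
  by apply: differentiableD; [exact: (g2 x).1 | exact: half_sqnorm_differentiable].
apply: gradient_differentiable => i.
have -> : (fun y : 'cV[R]_p => gradient (regularized nu g) y i 0) =
    (fun y => gradient g y i 0) + nu \*: (fun y : 'cV[R]_p => y i 0).
  by apply/funext => y; rewrite gradient_regularized // mxE; congr (_ + _); exact: mxE.
apply: differentiableD; first exact: differentiable_gradient_coord.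
by apply: differentiableZ; exact: differentiable_coord.
Qed.

Context {n : nat}.
Implicit Type G : 'I_n -> 'cV[R]_p -> R.

Let averageE G : average G = n%:R^-1 \*: \sum_i G i.
Proof. by apply/funext => w; rewrite /average /= fct_sumE. Qed.

Lemma gradient_average G x : (forall i, twice_differentiable (G i)) ->
  gradient (average G) x = n%:R^-1 *: \sum_i gradient (G i) x.
Proof.
move=> G2; apply/colP => k; rewrite !mxE averageE; apply: derive_val.
apply: is_derive_eq.
  apply: is_deriveZ; apply: is_derive_sum => i.
  exact/derivableP/diff_derivable/(G2 i x).1.
by rewrite summxE; congr (_ * _); apply: eq_bigr => i _; rewrite mxE.
Qed.

Lemma hessian_average G x : (forall i, twice_differentiable (G i)) ->
  hessian (average G) x = n%:R^-1 *: \sum_i hessian (G i) x.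
Proof.
move=> G2; apply/matrixP => j k; rewrite !mxE.
have -> : (fun y : 'cV[R]_p => gradient (average G) y j 0) =
    n%:R^-1 \*: \sum_i (fun y : 'cV[R]_p => gradient (G i) y j 0).
  by apply/funext => y; rewrite gradient_average // mxE summxE /= fct_sumE.
apply: derive_val; apply: is_derive_eq.
  apply: is_deriveZ; apply: is_derive_sum => i.
  exact/derivableP/diff_derivable/(differentiable_gradient_coord _).
by rewrite summxE; congr (_ * _); apply: eq_bigr => i _; rewrite mxE.
Qed.

Lemma twice_differentiable_average G : (forall i, twice_differentiable (G i)) ->
  twice_differentiable (average G).
Proof.
move=> G2 x; split.
  by rewrite averageE; apply: differentiableZ; apply: differentiable_sum => i;
    exact: (G2 i x).1.
apply: gradient_differentiable => k.
have -> : (fun y : 'cV[R]_p => gradient (average G) y k 0) =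
    n%:R^-1 \*: \sum_i (fun y : 'cV[R]_p => gradient (G i) y k 0).
  by apply/funext => y; rewrite gradient_average // mxE summxE /= fct_sumE.
apply: differentiableZ; apply: differentiable_sum => i.
exact: differentiable_gradient_coord.
Qed.

Lemma gradient_minimizer g x : twice_differentiable g -> is_minimizer g x ->
  gradient g x = 0.
Proof.
move=> g2 gmin; apply/colP => i.
have D := is_derive_line_grad g2 x (delta_mx i 0).
have N11 : (-1 : R) <= 1 by lra.
have in0 : (0 : R) \in `](-1), 1[ by rewrite in_itv /=; apply/andP; split; lra.
have dmin t : t \in `](-1 : R), 1[ -> derivable (fun s : R => g (x + s *: delta_mx i 0)) t 1.
  by move=> _; have [] := D t.
have minat t : t \in `](-1 : R), 1[ ->
    g (x + 0 *: delta_mx i 0) <= g (x + t *: delta_mx i 0).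
  by move=> _; rewrite scale0r addr0; exact: gmin.
have [_ E] := derive1_at_min N11 dmin in0 minat.
have [_] := D 0; rewrite E => /esym.
by rewrite scale0r addr0 /bform trmx_delta mulmx1 -rowE !mxE.
Qed.

End Regularization.

(** * Sampling without replacement: conditioning, increments and exponential moments *)

Section SubsetAverages.
Context {R : realType} {I : finType}.
Implicit Types (A B : {set I}) (h : {set I} -> R) (k : nat).

(** Expectation over a uniform draw of [k] elements. The population [A] is a parameter because
    conditioning on a drawn [i] leaves [A :\ i]. *)
Definition subset_avg k A h : R :=
  ('C(#|A|, k))%:R^-1 * \sum_(B : {set I} | (B \subset A) && (#|B| == k)) h B.

Lemma sum_draws_pointed k A (phi : I -> {set I} -> R) :
  \sum_(B : {set I} | (B \subset A) && (#|B| == k.+1)) \sum_(i in B) phi i B =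
  \sum_(i in A) \sum_(B : {set I} | (B \subset A :\ i) && (#|B| == k))
     phi i (i |: B)%SET.
Proof.
rewrite (exchange_big_dep (fun i => i \in A)) /=; last first.
  by move=> B i /andP[/fintype.subsetP BA _] /BA.
apply: eq_bigr => i iA.
rewrite (reindex_onto (fun B => i |: B)%SET (fun B => B :\ i)%SET) /=; last first.
  by move=> B /andP[_ iB]; rewrite finset.setD1K.
apply: eq_bigl => B; rewrite finset.setU11 andbT.
have [iB|iB] := boolP (i \in B).
  rewrite finset.subsetD1 iB andbF; apply/negP => /andP[_ /eqP E].
  by move: iB; rewrite -E finset.setD11.
rewrite finset.setU1K // eqxx andbT cardsU1 iB add1n eqSS; congr (_ && _).
by rewrite finset.subUset finset.sub1set iA finset.subsetD1 iB andbT.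
Qed.

(** Double counting of pairs [i \in B], with weights matched by [#|A| * 'C(#|A|.-1, k) = k.+1 *
    'C(#|A|, k.+1)]. A [phi] that ignores [i] yields conditioning on one draw; a bilinear [phi]
    yields the second moment. *)
Lemma subset_avg_pointed k A (phi : I -> {set I} -> R) : (k < #|A|)%N ->
  subset_avg k.+1 A (fun B => \sum_(i in B) phi i B) =
  k.+1%:R / #|A|%:R *
    \sum_(i in A) subset_avg k (A :\ i) (fun B => phi i (i |: B)%SET).
Proof.
move=> kA; rewrite /subset_avg sum_draws_pointed !mulr_sumr.
apply: eq_bigr => i iA; rewrite mulrA; congr (_ * _).
have A0 : (0 < #|A|)%N by apply: leq_ltn_trans kA.
have -> : #|(A :\ i)%SET| = #|A|.-1.
  by rewrite [in RHS](finset.cardsD1 i) iA.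
have k1 : (k <= #|A|.-1)%N by rewrite -ltnS prednK.
have/(congr1 (fun m => m%:R : R)) := mul_bin_diag #|A| k.
rewrite !natrM => E.
have c0 : 'C(#|A|, k.+1)%:R != 0 :> R by rewrite pnatr_eq0 -lt0n bin_gt0.
have c1 : 'C(#|A|.-1, k)%:R != 0 :> R by rewrite pnatr_eq0 -lt0n bin_gt0.
have a0 : #|A|%:R != 0 :> R by rewrite pnatr_eq0 -lt0n.
apply: (mulfI c0); rewrite mulfV //; apply: (mulIf c1); rewrite mul1r.
apply: (mulfI a0); rewrite E; field.
by rewrite a0 c1.
Qed.

Lemma subset_avg0 A h : subset_avg 0 A h = h finset.set0.
Proof.
rewrite /subset_avg bin0 invr1 mul1r (bigD1 finset.set0) /=; last first.
  by rewrite finset.sub0set cards0.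
rewrite big1 ?addr0 // => B /andP[/andP[_ /eqP/cards0_eq ->]].
by rewrite eqxx.
Qed.

Lemma subset_avgZ k A c h : subset_avg k A (fun B => c * h B) = c * subset_avg k A h.
Proof. by rewrite /subset_avg -mulr_sumr mulrCA. Qed.

Lemma subset_avgD k A h h' :
  subset_avg k A (fun B => h B + h' B) = subset_avg k A h + subset_avg k A h'.
Proof. by rewrite /subset_avg big_split mulrDr. Qed.

Lemma subset_avg_cst k A c : (k <= #|A|)%N -> subset_avg k A (fun=> c) = c.
Proof.
move=> kA; rewrite /subset_avg.
rewrite (eq_bigl (mem [set B : {set I} | B \subset A & #|B| == k]%SET)); last first.
  by move=> B; rewrite -[RHS]/(B \in _) inE.
by rewrite sumr_const cards_draws -[c *+ _]mulr_natl mulKf // pnatr_eq0 -lt0n bin_gt0.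
Qed.

Lemma subset_avg_le k A h h' : (forall B, B \subset A -> #|B| = k -> h B <= h' B) ->
  subset_avg k A h <= subset_avg k A h'.
Proof.
move=> H; rewrite ler_wpM2l ?invr_ge0 ?ler0n // ler_sum // => B /andP[? /eqP ?].
exact: H.
Qed.

Lemma eq_subset_avg k A h h' : (forall B, B \subset A -> #|B| = k -> h B = h' B) ->
  subset_avg k A h = subset_avg k A h'.
Proof.
move=> H; congr (_ * _); apply: eq_bigr => B /andP[? /eqP ?].
exact: H.
Qed.

Lemma subset_avgS k A h : (k < #|A|)%N ->
  subset_avg k.+1 A h =
  #|A|%:R^-1 * \sum_(i in A) subset_avg k (A :\ i) (fun B => h (i |: B)%SET).
Proof.
move=> kA; have k0 : k.+1%:R != 0 :> R by rewrite pnatr_eq0.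
have E := subset_avg_pointed (fun=> h) kA.
apply: (mulfI k0); rewrite -subset_avgZ mulrA -E.
apply: eq_subset_avg => B _ cB; rewrite sumr_const cB mulr_natl //.
Qed.

Variable v : I -> R.

(** A bounded difference condition by exchange of two elements, since altering one draw has to
    preserve the size of the subset. *)
Definition swap_lipschitz A h := forall i j B, i \in A -> j \in A ->
  B \subset A :\ i :\ j -> `|h (i |: B)%SET - h (j |: B)%SET| <= v i + v j.

Lemma swap_lipschitz_setU1 A h l : swap_lipschitz A h -> l \in A ->
  swap_lipschitz (A :\ l) (fun B => h (l |: B)%SET).
Proof.
move=> hA lA i j B; rewrite !inE => /andP[il iA] /andP[jl jA] BA.
rewrite ![(l |: (_ |: _))%SET]finset.setUCA; apply: hA => //.
rewrite finset.subUset finset.sub1set !inE eq_sym jl eq_sym il lA /=.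
apply: fintype.subset_trans BA _; apply: finset.setSD; apply: finset.setSD.
exact: finset.subD1set.
Qed.

(* The increments of the Doob martingale of [h]: the continuation of [i] that draws [j]
   is paired with the continuation of [j] that draws [i], as both give the same set. *)
Lemma doob_increment k A h i j : swap_lipschitz A h -> (k < #|A|)%N ->
  i \in A -> j \in A ->
  `|subset_avg k (A :\ i) (fun B => h (i |: B)%SET) -
    subset_avg k (A :\ j) (fun B => h (j |: B)%SET)| <= v i + v j.
Proof.
elim: k A h i j => [|k IHk] A h i j hA kA iA jA.
  by rewrite !subset_avg0; apply: hA => //; exact: finset.sub0set.
have vij : 0 <= v i + v j.
  by apply: le_trans (hA i j finset.set0 iA jA (finset.sub0set _)).
have [ij0|ij] := eqVneq i j; first by rewrite ij0 subrr normr0 -{1}ij0.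
have cA l : l \in A -> #|(A :\ l)%SET| = #|A|.-1.
  by move=> lA; rewrite [in RHS](finset.cardsD1 l) lA.
have kA' : (k < #|A|.-1)%N by rewrite -ltnS prednK // (leq_ltn_trans _ kA).
rewrite !subset_avgS ?cA // -mulrBr normrM ger0_norm ?invr_ge0 //.
rewrite ler_pdivrMl ?ltr0n ?(leq_ltn_trans _ kA') //.
rewrite (big_setD1 j) /= ?inE ?jA 1?eq_sym ?ij //.
rewrite [X in _ - X](big_setD1 i) /= ?inE ?iA ?ij //.
have -> : (A :\ j :\ i = A :\ i :\ j)%SET by rewrite finset.setDDl finset.setUC -finset.setDDl.
rewrite (eq_subset_avg (h' := fun B => h (j |: (i |: B))%SET)); last first.
  by move=> B _ _; rewrite finset.setUCA.
rewrite opprD addrACA subrr add0r -sumrB; apply: le_trans (ler_norm_sum _ _ _) _.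
apply: (@le_trans _ _ (\sum_(l in (A :\ i :\ j)%SET) (v i + v j))).
  apply: ler_sum => l; rewrite !inE => /and3P[lj li lA].
  have eD m : (A :\ m :\ l = A :\ l :\ m)%SET.
    by rewrite finset.setDDl finset.setUC -finset.setDDl.
  rewrite !eD.
  rewrite (eq_subset_avg (h' := fun B => h (l |: (i |: B))%SET)); last first.
    by move=> B _ _; rewrite finset.setUCA.
  rewrite [X in _ - X](eq_subset_avg (h' := fun B => h (l |: (j |: B))%SET)); last first.
    by move=> B _ _; rewrite finset.setUCA.
  apply: (IHk (A :\ l) (fun B => h (l |: B)%SET)).
  - exact: swap_lipschitz_setU1.
  - by rewrite cA.
  - by rewrite !inE eq_sym li.
  - by rewrite !inE eq_sym lj.
rewrite sumr_const -[(v i + v j) *+ _]mulr_natl; apply: ler_wpM2r => //.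
by rewrite ler_nat -(cA i) // subset_leq_card // finset.subD1set.
Qed.

(** Square [expR (x / 2) <= (1 - x / 2)^-1]; the remaining polynomial inequality reduces to
    [0 <= 1 - 3 * x + x ^+ 2]. The condition on [x] is one-sided, so martingale increments need only
    an upper bound. *)
Lemma expR_le_quadratic (x : R) : x <= 4^-1 -> expR x <= 1 + x + x ^+ 2.
Proof.
move=> x4; have y0 : 0 < 1 - x / 2 by lra.
have e1 : expR (x / 2) <= (1 - x / 2)^-1.
  rewrite -[expR _]invrK -expRN lef_pV2 ?posrE ?expR_gt0 //.
  by have := expR_ge1Dx (- (x / 2)).
have -> : expR x = expR (x / 2) ^+ 2 by rewrite -expRM_natl; congr expR; field.
have e2 : expR (x / 2) ^+ 2 <= (1 - x / 2) ^- 2.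
  by rewrite -exprVn ler_sqr ?nnegrE ?invr_ge0 ?expR_ge0 // ltW.
apply: le_trans e2 _; rewrite -[leLHS]mul1r ler_pdivrMr ?exprn_gt0 //.
have -> : (1 + x + x ^+ 2) * (1 - x / 2) ^+ 2 = 1 + x ^+ 2 / 4 * (1 - 3 * x + x ^+ 2).
  by field.
have : 0 <= x ^+ 2 by exact: sqr_ge0.
by nra.
Qed.

(** With [w] the mean of [v] over [A], averaging the hypothesis over [j] gives [v i + w] as a bound
    for the deviation of [D i]. Its square is at most [2 * v i ^+ 2 + 2 * w ^+ 2], and both parts
    sum to at most [2 * W]. *)
Lemma sum_sqr_centered A (D : I -> R) (W : R) : (0 < #|A|)%N ->
  (forall i j, i \in A -> j \in A -> `|D i - D j| <= v i + v j) ->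
  (forall i, 0 <= v i) ->
  \sum_(i in A) v i ^+ 2 <= W ->
  let m := #|A|%:R^-1 * \sum_(i in A) D i in
  \sum_(i in A) (D i - m) ^+ 2 <= 4 * W.
Proof.
move=> A0 DA v0 vW /=; set m := #|A|%:R^-1 * _; have a0 : 0 < #|A|%:R :> R by rewrite ltr0n.
pose w := #|A|%:R^-1 * \sum_(i in A) v i.
have cst (c : R) : \sum_(i in A) c = #|A|%:R * c by rewrite sumr_const mulr_natl.
have Dm i : i \in A -> `|D i - m| <= v i + w.
  move=> iA; rewrite -(ler_pM2l a0) -[leLHS](_ : `|#|A|%:R * (D i - m)| = _); last first.
    by rewrite normrM ger0_norm // ltW.
  rewrite mulrBr /m mulVKf ?gt_eqF // -cst -sumrB.
  rewrite mulrDr /w mulVKf ?gt_eqF // -cst -big_split /=.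
  by apply: le_trans (ler_norm_sum _ _ _) (ler_sum _ _) => j jA; exact: DA.
have w0 : 0 <= w by apply: mulr_ge0; [rewrite invr_ge0 ltW | exact: sumr_ge0].
have ww : #|A|%:R * w ^+ 2 <= \sum_(i in A) v i ^+ 2.
  have : 0 <= \sum_(i in A) (v i - w) ^+ 2 by apply: sumr_ge0 => i _; exact: sqr_ge0.
  have -> : \sum_(i in A) (v i - w) ^+ 2 =
      \sum_(i in A) v i ^+ 2 - 2 * w * (\sum_(i in A) v i) + #|A|%:R * w ^+ 2.
    rewrite -cst mulr_sumr -sumrB -big_split /=; apply: eq_bigr => i _; ring.
  have -> : \sum_(i in A) v i = #|A|%:R * w by rewrite /w mulVKf ?gt_eqF.
  by lra.
apply: (@le_trans _ _ (\sum_(i in A) (2 * v i ^+ 2 + 2 * w ^+ 2))).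
  apply: ler_sum => i iA; have := Dm i iA; have := v0 i.
  rewrite ler_norml => ? /andP[? ?]; have := sqr_ge0 (v i - w).
  by nra.
rewrite big_split /= cst -mulr_sumr; lra.
Qed.

(** Induction on the draws. After conditioning on one of them, the quadratic bound on [expR] has a
    linear term of mean zero and a quadratic term of mean at most [lam ^+ 2 * (4 * W / #|A|)]. The
    number [#|A| - k] does not change along the recursion, so the hypothesis relating [W] and [V]
    covers every population size that is met. *)
Lemma subset_avg_expR (lam Bd W V : R) k A h :
  0 <= lam -> 8 * lam * Bd <= 1 -> (forall i, 0 <= v i <= Bd) ->
  \sum_i v i ^+ 2 <= W -> 0 <= V -> (k <= #|A|)%N ->
  (forall l, (#|A| - k <= l)%N -> 4 * W <= l.+1%:R * V) ->
  swap_lipschitz A h ->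
  subset_avg k A (fun B => expR (lam * h B)) <=
  expR (lam * subset_avg k A h + k%:R * (lam ^+ 2 * V)).
Proof.
move=> lam0 lamB vB vW V0.
elim: k A h => [|k IHk] A h kA WV hA.
  by rewrite !subset_avg0 mul0r addr0.
have A0 : (0 < #|A|)%N by apply: leq_ltn_trans kA.
have a0 : 0 < #|A|%:R :> R by rewrite ltr0n.
have cA l : l \in A -> #|(A :\ l)%SET| = #|A|.-1.
  by move=> lA; rewrite [in RHS](finset.cardsD1 l) lA.
have kA1 : (k <= #|A|.-1)%N by rewrite -ltnS prednK.
rewrite !subset_avgS //.
pose D i := subset_avg k (A :\ i) (fun B => h (i |: B)%SET).
have DA i j : i \in A -> j \in A -> `|D i - D j| <= v i + v j.
  by move=> iA jA; exact: doob_increment.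
set m := #|A|%:R^-1 * \sum_(i in A) subset_avg k (A :\ i) (fun B => h (i |: B)%SET).
have mE : m = #|A|%:R^-1 * \sum_(i in A) D i by [].
have step1 : #|A|%:R^-1 *
      (\sum_(i in A) subset_avg k (A :\ i) (fun B => expR (lam * h (i |: B)%SET))) <=
    #|A|%:R^-1 * (\sum_(i in A) (1 + lam * (D i - m) + (lam * (D i - m)) ^+ 2) *
      expR (lam * m + k%:R * (lam ^+ 2 * V))).
  rewrite ler_wpM2l ?invr_ge0 ?ler0n //; apply: ler_sum => i iA.
  apply: le_trans (IHk _ _ _ _ (swap_lipschitz_setU1 hA iA)) _.
  - by rewrite cA.
  - move=> l; rewrite cA // => lk; apply: WV.
    by apply: leq_trans lk; rewrite -subn1 -subnDA add1n.
  rewrite -/(D i).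
  have -> : lam * D i + k%:R * (lam ^+ 2 * V) =
     lam * (D i - m) + (lam * m + k%:R * (lam ^+ 2 * V)) by ring.
  rewrite expRD ler_wpM2r ?expR_ge0 // expR_le_quadratic //.
  (* Together with [8 * lam * Bd <= 1] this puts the exponent below [1 / 4]. *)
  have Dm : D i - m <= 2 * Bd.
    rewrite -(ler_pM2l a0) mulrBr mE mulVKf ?gt_eqF //.
    have cst (c : R) : \sum_(i in A) c = #|A|%:R * c by rewrite sumr_const mulr_natl.
    rewrite -!cst -sumrB; apply: ler_sum => j jA; apply: le_trans (ler_norm _) _.
    apply: le_trans (DA _ _ iA jA) _.
    by have /andP[_ ?] := vB i; have /andP[_ ?] := vB j; lra.
  apply: (@le_trans _ _ (lam * (2 * Bd))); first by rewrite ler_wpM2l.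
  by lra.
apply: le_trans step1 _.
rewrite -mulr_suml [#|A|%:R^-1 * _]mulrA.
have -> : lam * m + k.+1%:R * (lam ^+ 2 * V) = lam ^+ 2 * V + (lam * m + k%:R * (lam ^+ 2 * V)).
  by rewrite -natr1; ring.
rewrite [leRHS]expRD ler_wpM2r ?expR_ge0 //.
apply: le_trans (expR_ge1Dx _).
have vA : \sum_(i in A) v i ^+ 2 <= W.
  apply: le_trans vW; rewrite [leRHS](bigID (mem A)) /= lerDl.
  by apply: sumr_ge0 => i _; exact: sqr_ge0.
have Q := sum_sqr_centered A0 DA (fun i => proj1 (andP (vB i))) vA.
rewrite /= -mE in Q.
rewrite !big_split /= -mulr_sumr.
have -> : \sum_(i in A) (D i - m) = 0.
  rewrite sumrB sumr_const mE -[_ *+ _]mulr_natl mulVKf ?gt_eqF //.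
  by rewrite subrr.
rewrite mulr0 addr0 sumr_const mulrDr mulVf ?gt_eqF // lerD2l.
under eq_bigr do rewrite exprMn.
rewrite -mulr_sumr mulrCA ler_wpM2l ?sqr_ge0 // ler_pdivrMl //.
apply: le_trans Q _.
have := WV #|A|.-1; rewrite prednK //; apply.
by rewrite -subn1 leq_sub2l.
Qed.

End SubsetAverages.

(** * Concentration of the norm of a sampled sum of vectors *)

Section VectorSampling.
Context {R : realType} {I : finType} {p : nat}.
Variables (P : 'M[R]_p) (X : I -> 'cV[R]_p).
Hypothesis P_psd : psd P.

Let S (B : {set I}) := \sum_(i in B) X i.

Let S_setU1 i (B : {set I}) : i \notin B -> S (i |: B)%SET = X i + S B.
Proof. by move=> iB; rewrite /S big_setU1. Qed.

Lemma swap_lipschitz_wnorm_sum A :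
  swap_lipschitz (fun i => wnorm P (X i)) A (fun B => wnorm P (S B)).
Proof.
move=> i j B iA jA BA.
have jB : j \notin B by apply/negP => /(fintype.subsetP BA); rewrite !inE eqxx.
have iB : i \notin B by apply/negP => /(fintype.subsetP BA); rewrite !inE eqxx andbF.
rewrite !S_setU1 // ler_norml; apply/andP; split.
  rewrite lerNl opprB; apply: le_trans (wnormB_le _ _ P_psd) _.
  rewrite opprD addrACA subrr addr0 addrC -(wnormN P (X i)).
  exact: wnormD.
apply: le_trans (wnormB_le _ _ P_psd) _.
rewrite opprD addrACA subrr addr0 -(wnormN P (X j)).
exact: wnormD.
Qed.

Hypothesis X0 : \sum_i X i = 0.

(** Draws without replacement from a centered population are negatively correlated: for fixed [i]
    the forms [bform P (X i) (X j)] with [j != i] sum to [- qform P (X i)]. The cross terms can thus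
    be dropped, leaving the second moment of independent draws. *)
Lemma subset_avg_qform_sum k : (k < #|I|)%N ->
  subset_avg k.+1 [set: I] (fun B => qform P (S B)) <=
  k.+1%:R / #|I|%:R * \sum_i qform P (X i).
Proof.
move=> kI; pose phi i B := bform P (X i) (S B).
rewrite (eq_subset_avg (h' := fun B => \sum_(i in B) phi i B)); last first.
  by move=> B _ _; rewrite qformE {1}/S bform_suml.
rewrite subset_avg_pointed ?finset.cardsT // ler_wpM2l ?divr_ge0 ?ler0n //.
rewrite (eq_bigl xpredT) => [|i]; last by rewrite finset.in_setT.
apply: ler_sum => i _.
have cI : #|([set: I] :\ i)%SET| = #|I|.-1.
  by rewrite -[in RHS]finset.cardsT (finset.cardsD1 i [set: I]%SET) finset.in_setT.
rewrite (eq_subset_avg (h' := fun B => qform P (X i) + bform P (X i) (S B))); last first.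
  move=> B BA _; rewrite /phi S_setU1 ?bformDr //.
  by apply/negP => /(fintype.subsetP BA); rewrite !inE eqxx.
have k1 : (k <= #|([set: I] :\ i)%SET|)%N by rewrite cI -ltnS prednK // (leq_ltn_trans _ kI).
rewrite subset_avgD subset_avg_cst // gerDl.
case: k kI k1 => [|k] kI k1; first by rewrite subset_avg0 /S big_set0 bform0r.
rewrite (eq_subset_avg (h' := fun B => \sum_(j in B) bform P (X i) (X j))); last first.
  by move=> B _ _; rewrite /S bform_sumr.
rewrite (subset_avg_pointed (fun j _ => bform P (X i) (X j))) //.
apply: mulr_ge0_le0; first by rewrite divr_ge0 ?ler0n.
rewrite (eq_bigr (fun j => bform P (X i) (X j))); last first.
  move=> j jA; rewrite subset_avg_cst // -ltnS (leq_trans k1) //.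
  by rewrite [X in (X <= _)%N](finset.cardsD1 j) jA add1n.
have := congr1 (bform P (X i)) X0; rewrite bform_sumr bform0r (bigD1 i) //=.
move/eqP; rewrite addrC addr_eq0 => /eqP.
rewrite (eq_bigl (fun j => j \in ([set: I] :\ i)%SET)); last by move=> j; rewrite !inE andbT.
by move=> ->; rewrite oppr_le0; exact: (proj2 P_psd).
Qed.

(* A Bernstein inequality without dimension factor for sampling without replacement; the
   condition [2 b <= #|I|] keeps the conditional variances within a factor 2 of [V]. *)
Lemma sampling_tail (b : nat) (V t lam Bd : R) :
  (0 < b)%N -> (2 * b <= #|I|)%N -> 0 < t -> 0 <= lam -> 8 * lam * Bd <= 1 ->
  (forall i, wnorm P (X i) <= Bd) ->
  \sum_i qform P (X i) <= #|I|%:R * V ->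
  #|[set B : {set I} | (#|B| == b) && (b%:R * t < wnorm P (\sum_(i in B) X i))]%SET|%:R <=
  expR (lam * (2 * V / t - 7 / 8 * (b%:R * t)) + 8 * lam ^+ 2 * b%:R * V) *
  'C(#|I|, b)%:R.
Proof.
move=> b0 bI t0 lam0 lamB XB XV.
have I0 : (0 < #|I|)%N by apply: leq_trans bI; rewrite muln_gt0.
have i0 : 0 < #|I|%:R :> R by rewrite ltr0n.
have br : 0 < b%:R :> R by rewrite ltr0n.
have V0 : 0 <= V.
  rewrite -(pmulr_rge0 _ i0); apply: le_trans XV; apply: sumr_ge0 => i _.
  exact: (proj2 P_psd).
have bI' : (b <= #|[set: I]%SET|)%N by rewrite finset.cardsT (leq_trans _ bI) // leq_pmull.
have mean : subset_avg b [set: I] (fun B => wnorm P (S B)) <= 2 * V / t + b%:R * t / 8.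
  (* The inequality [z <= z ^+ 2 / (2 * c) + c / 2] bounds the mean norm by the second moment
     without a square root. This [c] makes the mean consume only [1 / 8] of the threshold [b * t],
     which leaves the factor [7 / 8] in the exponent. *)
  pose c := b%:R * t / 4; have c0 : 0 < c by rewrite divr_gt0 ?mulr_gt0.
  apply: (@le_trans _ _ (subset_avg b [set: I]
      (fun B => (2 * c)^-1 * qform P (S B) + c / 2))).
    apply: subset_avg_le => B _ _; rewrite -(sqr_wnorm _ P_psd).
    rewrite -(ler_pM2l (_ : 0 < 2 * c)) ?mulr_gt0 // mulrDr mulVKf;
      last by rewrite mulf_neq0 ?gt_eqF.
    have := sqr_ge0 (wnorm P (S B) - c); move: (wnorm _ _) c {c0} => z c.
    have -> : 2 * c * (c / 2) = c ^+ 2 by field.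
    have -> : (z - c) ^+ 2 = z ^+ 2 + c ^+ 2 - 2 * c * z by ring.
    by rewrite subr_ge0.
  rewrite subset_avgD subset_avg_cst // subset_avgZ.
  have -> : b%:R * t / 8 = c / 2 by rewrite /c; field.
  rewrite lerD2r ler_pdivrMl ?mulr_gt0 //.
  have -> : 2 * c * (2 * V / t) = b%:R * V by rewrite /c; field; rewrite gt_eqF.
  have := @subset_avg_qform_sum b.-1; rewrite !prednK // => H.
  apply: le_trans (H _) _; first by rewrite (leq_trans _ bI) // leq_pmull.
  by rewrite -mulrA ler_pM2l // ler_pdivrMl.
have mgf : subset_avg b [set: I] (fun B => expR (lam * wnorm P (S B))) <=
   expR (lam * subset_avg b [set: I] (fun B => wnorm P (S B)) + b%:R * (lam ^+ 2 * (8 * V))).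
  apply: (subset_avg_expR (v := fun i => wnorm P (X i)) (Bd := Bd) (W := #|I|%:R * V)) => //.
  - by move=> i; rewrite wnorm_ge0 XB.
  - by apply: le_trans XV; apply: ler_sum => i _; rewrite (sqr_wnorm _ P_psd).
  - by rewrite mulr_ge0.
  - move=> l; rewrite finset.cardsT => Il.
    have : #|I|%:R <= 2 * l.+1%:R :> R.
      rewrite -natrM ler_nat; apply: (@leq_trans (2 * (#|I| - b))); last first.
        by rewrite leq_mul2l /= (leq_trans Il).
      by rewrite mulnBr mul2n -addnn -addnBA // leq_addr.
    have -> : l.+1%:R * (8 * V) = 4 * (2 * l.+1%:R * V) by ring.
    by rewrite ler_pM2l // => ?; rewrite ler_wpM2r.
  - exact: swap_lipschitz_wnorm_sum.
set bad := finset _.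
have markov : #|bad|%:R * expR (lam * (b%:R * t)) <=
    'C(#|I|, b)%:R * subset_avg b [set: I] (fun B => expR (lam * wnorm P (S B))).
  have C0 : 'C(#|I|, b)%:R != 0 :> R by rewrite pnatr_eq0 -lt0n bin_gt0 -finset.cardsT.
  rewrite /subset_avg finset.cardsT mulVKf //.
  rewrite mulr_natl -sumr_const.
  apply: (@le_trans _ _ (\sum_(B in bad) expR (lam * wnorm P (S B)))).
    apply: ler_sum => B; rewrite inE => /andP[_ /ltW H].
    by rewrite ler_expR ler_wpM2l.
  rewrite [leRHS](bigID (mem bad)) /= -[leLHS]addr0 lerD //.
    rewrite le_eqVlt; apply/orP; left; apply/eqP; apply: eq_bigl => B.
    by rewrite !inE finset.subsetT /=; case: eqP.
  by apply: sumr_ge0 => B _; exact: expR_ge0.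
have e0 : 0 < expR (lam * (b%:R * t)) by exact: expR_gt0.
rewrite -(ler_pM2r e0); apply: le_trans markov _.
rewrite [leRHS]mulrAC -expRD mulrC ler_wpM2r ?ler0n //.
apply: le_trans mgf _; rewrite ler_expR.
have := ler_wpM2l lam0 mean.
move: (subset_avg _ _ _) => z; move: (2 * V / t) => y; lra.
Qed.

End VectorSampling.

(** * Union bound for events that depend on the past draws *)

Section AdaptiveRuns.
Context {R : realType} {n : nat}.
Variable good : seq {set 'I_n} -> {set 'I_n} -> bool.

(** The predicate receives the whole past [pre] because the quality of a draw is judged at the
    iterate which that past produced. *)
Fixpoint good_run (pre s : seq {set 'I_n}) : bool :=
  if s is B :: s' then good pre B && good_run (rcons pre B) s' else true.

Lemma good_run_nth (pre s : seq {set 'I_n}) t : good_run pre s -> (t < size s)%N ->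
  good (pre ++ take t s) (nth finset.set0 s t).
Proof.
elim: s pre t => [|B s IHs] pre [|t] //= /andP[gB gs] ts; first by rewrite cats0.
by rewrite -cat_rcons; exact: IHs.
Qed.

Lemma sum_tuple_cons (T : finType) (m : nat) (F : m.+1.-tuple T -> R) :
  \sum_(om : m.+1.-tuple T) F om =
  \sum_(x : T) \sum_(om : m.-tuple T) F [tuple of x :: om].
Proof.
rewrite pair_bigA /= (reindex (fun x : T * m.-tuple T => [tuple of x.1 :: x.2])) //=.
exists (fun om => (thead om, [tuple of behead om])) => [[x om] _|om _] /=.
  by rewrite theadE; congr (_, _); apply: val_inj.
by rewrite [RHS]tuple_eta.
Qed.

Variables (b : nat) (q : R).
Hypotheses (q01 : 0 <= q <= 1) (bn : (b <= n)%N).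
Hypothesis bad_draws : forall pre,
  #|[set B : {set 'I_n} | (#|B| == b) && ~~ good pre B]%SET|%:R <= q * 'C(n, b)%:R.

Lemma good_draws pre :
  (1 - q) * 'C(n, b)%:R <= \sum_(B : {set 'I_n}) ((#|B| == b) && good pre B)%:R.
Proof.
have /= E : \sum_(B : {set 'I_n}) ((#|B| == b) && good pre B)%:R +
    #|[set B : {set 'I_n} | (#|B| == b) && ~~ good pre B]%SET|%:R = 'C(n, b)%:R :> R.
  have -> : 'C(n, b) = #|[set B : {set 'I_n} | #|B| == b]%SET|.
    by rewrite card_draws card_ord.
  rewrite -!sum1dep_card !natr_sum [in RHS]big_mkcond [X in _ + X]big_mkcond -big_split /=.
  apply: eq_bigr => B _; case: (#|B| == b) => /=; last by rewrite addr0.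
  by case: (good pre B); rewrite /= ?addr0 ?add0r.
have := bad_draws pre; rewrite -E; lra.
Qed.

(** [bad_draws] is uniform in the past, so the first draw can be peeled off and the rest treated
    with the prefix extended by it; the conditional success rates multiply. *)
Lemma sum_good_runs m pre :
  ((1 - q) * 'C(n, b)%:R) ^+ m <=
  \sum_(om : m.-tuple {set 'I_n})
    (all (fun B : {set 'I_n} => #|B| == b) om && good_run pre om)%:R.
Proof.
have /andP[q0 q1] := q01.
elim: m pre => [|m IHm] pre.
  rewrite expr0 (bigD1 [tuple]) //= lerDl.
  exact: sumr_ge0.
rewrite sum_tuple_cons exprS.
apply: (@le_trans _ _ (\sum_(B : {set 'I_n}) ((#|B| == b) && good pre B)%:R *
    ((1 - q) * 'C(n, b)%:R) ^+ m)).
  rewrite -mulr_suml ler_wpM2r ?good_draws // exprn_ge0 // mulr_ge0 ?subr_ge0 //.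
apply: ler_sum => B _ /=; case: (#|B| == b) => /=; last by rewrite mul0r sumr_ge0.
case: (good pre B) => /=; last by rewrite mul0r sumr_ge0.
by rewrite mul1r; exact: IHm.
Qed.

Lemma bernoulli_ineq m : 1 - m%:R * q <= (1 - q) ^+ m.
Proof.
have /andP[q0 q1] := q01.
elim: m => [|m IHm]; first by rewrite mul0r subr0.
rewrite exprS -natr1; have m0 : 0 <= m%:R :> R by [].
have : (1 - q) * (1 - m%:R * q) <= (1 - q) * (1 - q) ^+ m by rewrite ler_wpM2l ?subr_ge0.
have : 0 <= m%:R * q * q by rewrite !mulr_ge0.
lra.
Qed.

(** The product [(1 - q) ^+ m] of conditional success rates is weakened by Bernoulli's inequality to
    the form of a union bound. *)
Lemma prob_good_runs m (E : pred (m.-tuple {set 'I_n})) :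
  (forall om : m.-tuple {set 'I_n}, all (fun B : {set 'I_n} => #|B| == b) om ->
     good_run [::] om -> E om) ->
  1 - m%:R * q <= finite_uniform_prob R (minibatch_runs n b m) E.
Proof.
move=> gE; have C0 : 0 < 'C(n, b)%:R :> R by rewrite ltr0n bin_gt0.
have cardE (Q : pred (m.-tuple {set 'I_n})) : #|[set x | Q x]%SET|%:R = \sum_x (Q x)%:R :> R.
  rewrite -sum1dep_card natr_sum big_mkcond /=; apply: eq_bigr => x _.
  by case: (Q x).
have cR : #|minibatch_runs n b m|%:R = 'C(n, b)%:R ^+ m :> R.
  rewrite /minibatch_runs cardE.
  elim: m {E gE cardE} => [|k IHk].
    rewrite expr0 (bigD1 [tuple]) //= big1 ?addr0 // => om; case/eqP.
    by apply: val_inj; case: (om) => [[]].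
  rewrite sum_tuple_cons exprS -IHk.
  have -> : 'C(n, b)%:R = \sum_(B : {set 'I_n}) (#|B| == b)%:R :> R.
    rewrite -[n in 'C(n, b)]card_ord -card_draws -sum1dep_card natr_sum big_mkcond /=.
    by apply: eq_bigr => B _; case: eqP.
  rewrite mulr_suml; apply: eq_bigr => B _ /=; case: (#|B| == b) => /=.
    by rewrite mul1r.
  by rewrite mul0r big1.
rewrite /finite_uniform_prob cR ler_pdivlMr ?exprn_gt0 //.
apply: (@le_trans _ _ ((1 - q) ^+ m * 'C(n, b)%:R ^+ m)).
  by rewrite ler_wpM2r ?exprn_ge0 // bernoulli_ineq.
rewrite -exprMn; apply: le_trans (sum_good_runs m [::]) _.
rewrite -cardE ler_nat subset_leq_card //; apply/fintype.subsetP => om.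
by rewrite !inE => /andP[a g]; rewrite a gE.
Qed.

End AdaptiveRuns.

(** * From the dissimilarity constant to Loewner bounds on component Hessians *)

Section Dissimilarity.
Context {R : realType} {p n : nat}.

(** Substituting [S *m y] for [x] turns [H] into the identity and [A] into [S *m A *m S], so
    comparison with [H] becomes a bound on the spectrum. *)
Lemma whitened_eigenvalue (H A : 'M[R]_p) (c : R) : spd H -> A^T = A -> 0 <= c ->
  (forall x, qform A x <= c * qform H x) ->
  let l := lambda1 (inv_sqrtmx H *m A *m inv_sqrtmx H) in
  l <= c /\ forall x, qform A x <= l * qform H x.
Proof.
move=> Hspd As c0 Ac; set S := inv_sqrtmx H; rewrite /=; set l := lambda1 _.
have [[Ss S0] SS] := inv_sqrtmx_spec Hspd; rewrite -/S in Ss S0 SS.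
have Hu := spd_unitmx Hspd.
have Su : S \in unitmx by exact: spd_unitmx.
have qA y : qform (S *m A *m S) y = qform A (S *m y).
  by rewrite /qform trmx_mul Ss !mulmxA.
have SHS : S *m H *m S = 1%:M.
  rewrite -[LHS](mulmxK Su) -[_ *m S *m S]mulmxA SS.
  by rewrite -[S *m H *m _]mulmxA mulmxV // mulmx1 mulmxV.
have qH y : qform H (S *m y) = qform 1%:M y.
  by rewrite -SHS /qform trmx_mul Ss !mulmxA.
have Bs : (S *m A *m S)^T = S *m A *m S by rewrite !trmx_mul Ss As mulmxA.
have Bc y : qform (S *m A *m S) y <= c * qform 1%:M y by rewrite qA -qH.
split; first exact: lambda1_le.
move=> x; have := qform_le_lambda1 (invmx S *m x) Bs Bc.
by rewrite qA -qH mulmxA mulmxV // mul1mx.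
Qed.

Variables (nu : R) (f : 'I_n -> 'cV[R]_p -> R) (C : set 'cV[R]_p).
Let H i w := hessian (f i) w + nu%:M.
Let Hbar w := hessian (average f) w + nu%:M.
Hypotheses (n0 : (0 < n)%N) (H_psd : forall i w, psd (H i w))
  (Hbar_spd : forall w, spd (Hbar w))
  (HbarE : forall w, Hbar w = n%:R^-1 *: \sum_i H i w).

Let qHbar w x : n%:R * qform (Hbar w) x = \sum_i qform (H i w) x.
Proof.
rewrite HbarE qformE bform_mxZ bform_mx_sum mulVKf // pnatr_eq0 -lt0n //.
Qed.

Let H_le w i x : qform (H i w) x <= n%:R * qform (Hbar w) x.
Proof.
rewrite qHbar (bigD1 i) //= lerDl; apply: sumr_ge0 => j _.
exact: (proj2 (H_psd j w)).
Qed.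

Lemma qform_le_dissimilarity w i x : C w ->
  qform (H i w) x <= dissimilarity nu f C * qform (Hbar w) x.
Proof.
move=> Cw; have nr : 0 <= n%:R :> R by [].
have W i' w' := whitened_eigenvalue (Hbar_spd w') (proj1 (H_psd i' w')) nr (H_le w' i').
apply: le_trans (proj2 (W i w) x) _.
apply: ler_wpM2r; first exact: (proj2 (spd_psd (Hbar_spd w))).
set E := fun w' => \big[Num.max/0]_(j < n)
  lambda1 (inv_sqrtmx (Hbar w') *m H j w' *m inv_sqrtmx (Hbar w')).
apply: (@le_trans _ _ (E w)); first exact: le_bigmax.
apply: ub_le_sup; last by exists w.
exists n%:R => _ [w' _ <-]; apply: bigmax_le => // j _.
exact: (proj1 (W j w')).
Qed.

(** Summing [qform_le_dissimilarity] over [i] compares [Hbar w] with itself; [0 < p] provides a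
    nonzero vector on which to test. *)
Lemma dissimilarity_ge1 w : C w -> (0 < p)%N -> 1 <= dissimilarity nu f C.
Proof.
move=> Cw p0; pose x : 'cV[R]_p := const_mx 1.
have x0 : x != 0.
  apply/eqP => /colP/(_ (Ordinal p0)); rewrite !mxE => /eqP.
  by rewrite oner_eq0.
have qx := proj2 (Hbar_spd w) x x0.
have nr : 0 < n%:R :> R by rewrite ltr0n.
rewrite -(ler_pM2r (mulr_gt0 nr qx)) mul1r mulrCA qHbar.
rewrite [leRHS](_ : _ = \sum_(i < n) dissimilarity nu f C * qform (Hbar w) x).
  by apply: ler_sum => i _; exact: qform_le_dissimilarity.
by rewrite sumr_const card_ord mulr_natl.
Qed.

End Dissimilarity.

(** * Deterministic and stochastic analysis inside the neighbourhood *)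

Section LocalAnalysis.
(* Otherwise unification unfolds these to compare Hessians at distinct points. *)
#[local] Opaque hessian gradient qform bform wnorm norm2.
Context {R : realType} {p n : nat}.
Variables (G : 'I_n -> 'cV[R]_p -> R) (nu M eps0 : R) (wstar : 'cV[R]_p).
Hypotheses (n0 : (0 < n)%N) (nu0 : 0 < nu) (M0 : 0 < M) (eps_range : 0 < eps0 <= 1 / 6).
Hypothesis G2 : forall i, twice_differentiable (G i).
Hypothesis GM : forall i, lipschitz_hessian M (G i).
Hypothesis Gnu : forall i w x, nu * qform 1%:M x <= qform (hessian (G i) w) x.
Hypothesis wstar_min : is_minimizer (average G) wstar.

Notation F := (average G).
Notation N := (local_nbhd (average G) nu M eps0 wstar).

Let nr : 0 < n%:R :> R. Proof. by rewrite ltr0n. Qed.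

Lemma twice_differentiable_F : twice_differentiable F.
Proof. exact: twice_differentiable_average. Qed.

Lemma hessian_G_psd i w : psd (hessian (G i) w).
Proof.
split; first exact: (hessian_sym (G2 i) (GM i)).
by move=> x; apply: le_trans (Gnu i w x); rewrite mulr_ge0 ?qform1_ge0 // ltW.
Qed.

Lemma qform_hessian_F w x : n%:R * qform (hessian F w) x = \sum_i qform (hessian (G i) w) x.
Proof.
by rewrite hessian_average // qformE bform_mxZ bform_mx_sum mulVKf ?gt_eqF.
Qed.

Lemma hessian_F_nu w x : nu * qform 1%:M x <= qform (hessian F w) x.
Proof.
rewrite -(ler_pM2l nr) qform_hessian_F.
rewrite [leLHS](_ : _ = \sum_(i < n) nu * qform 1%:M x).
  by apply: ler_sum => i _; exact: Gnu.
by rewrite sumr_const card_ord mulr_natl.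
Qed.

Lemma hessian_F_sym w : (hessian F w)^T = hessian F w.
Proof.
rewrite hessian_average // linearZ linear_sum /=; congr (_ *: _).
by apply: eq_bigr => i _; exact: (proj1 (hessian_G_psd i w)).
Qed.

Lemma hessian_F_spd w : spd (hessian F w).
Proof.
split; first exact: hessian_F_sym.
by move=> x x0; apply: lt_le_trans (hessian_F_nu w x); rewrite mulr_gt0 // qform1_gt0.
Qed.

(** The power [3 / 2] in the radius splits as [nu * Num.sqrt nu]. The square root pays for passing
    from the Hessian norm to the Euclidean one, and [nu] remains to be matched with the lower bound
    on the Hessians. *)
Lemma nbhd_norm2 w : N w -> norm2 (w - wstar) <= eps0 * nu / (2 * M).
Proof.
move=> Nw; have s0 : 0 < Num.sqrt nu by rewrite sqrtr_gt0.
have le1 : Num.sqrt nu * norm2 (w - wstar) <= wnorm (hessian F wstar) (w - wstar).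
  by apply: scale_norm2_le (hessian_F_nu _ _); exact: ltW.
have nu32 : nu `^ (3 / 2) = nu * Num.sqrt nu.
  rewrite (_ : 3 / 2 = 1 + 2^-1) ?powRD ?gt_eqF ?implybT //; last by field.
  by rewrite powRr1 ?(ltW nu0) // powR12_sqrt // ltW.
rewrite -(ler_pM2l s0); apply: le_trans le1 _; apply: le_trans Nw _.
rewrite nu32 le_eqVlt; apply/orP; left; apply/eqP; field; rewrite gt_eqF //.
Qed.

Lemma nbhd_wstar : N wstar.
Proof.
have /andP[e0 _] := eps_range.
by rewrite /local_nbhd /= subrr wnorm0 divr_ge0 ?mulr_ge0 ?powR_ge0 ?(ltW e0) ?(ltW M0).
Qed.

Lemma nbhd_segment x y c : N x -> N y -> 0 <= c -> c <= 1 -> N (x + c *: (y - x)).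
Proof.
rewrite /local_nbhd /=; move: (eps0 * _ / _) => r Nx Ny c0 c1.
have -> : x + c *: (y - x) - wstar = (1 - c) *: (x - wstar) + c *: (y - wstar).
  by apply/colP => i; rewrite !mxE; ring.
apply: le_trans (wnormD _ _ (spd_psd (hessian_F_spd wstar))) _.
rewrite !wnormZ !ger0_norm ?subr_ge0 //.
have -> : r = (1 - c) * r + c * r by ring.
by rewrite lerD // ler_wpM2l // subr_ge0.
Qed.

(** On [N] the Lipschitz error is at most [eps0 / 2 * nu <= nu / 12]. Since [nu] bounds every
    component Hessian from below, this absolute error is also a relative one. *)
Lemma hessian_G_close i w x : N w ->
  `|qform (hessian (G i) w) x - qform (hessian (G i) wstar) x| <=
  1 / 12 * qform (hessian (G i) wstar) x.
Proof.
move=> Nw; rewrite -(qform_mxB (hessian (G i) w) (hessian (G i) wstar) x) qformE.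
apply: le_trans (lipschitz_hessian_bform (GM i) _ _ _ _) _.
rewrite -mulrA -expr2 sqr_norm2.
have q0 := qform1_ge0 x.
apply: (@le_trans _ _ (1 / 12 * nu * qform 1%:M x)); last first.
  by rewrite -mulrA ler_wpM2l // Gnu.
apply: ler_wpM2r => //.
apply: le_trans (ler_wpM2l (ltW M0) (nbhd_norm2 Nw)) _.
have -> : M * (eps0 * nu / (2 * M)) = eps0 / 2 * nu by field; rewrite gt_eqF.
by have /andP[_ ?] := eps_range; rewrite ler_wpM2r ?(ltW nu0) //; lra.
Qed.

Lemma hessian_G_bounds i w x : N w ->
  11 / 12 * qform (hessian (G i) wstar) x <= qform (hessian (G i) w) x <=
  13 / 12 * qform (hessian (G i) wstar) x.
Proof.
have aux (a b : R) : `|a - b| <= 1 / 12 * b -> 11 / 12 * b <= a <= 13 / 12 * b.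
  by rewrite ler_norml => /andP[? ?]; apply/andP; split; lra.
by move=> /(hessian_G_close i x)/aux.
Qed.

Lemma hessian_G_le i w x : N w ->
  qform (hessian (G i) w) x <= 13 / 12 * qform (hessian (G i) wstar) x.
Proof. by move=> /(hessian_G_bounds i x)/andP[]. Qed.

Lemma hessian_G_ge i w x : N w ->
  11 / 12 * qform (hessian (G i) wstar) x <= qform (hessian (G i) w) x.
Proof. by move=> /(hessian_G_bounds i x)/andP[]. Qed.

Lemma hessian_F_le w x : N w ->
  qform (hessian F w) x <= 13 / 12 * qform (hessian F wstar) x.
Proof.
have aux (m q q' s s' k : R) : 0 < m -> m * q = s -> m * q' = s' -> s <= k * s' -> q <= k * q'.
  by move=> m0 <- <-; rewrite mulrCA ler_pM2l.
move=> Nw; apply: aux nr (qform_hessian_F w x) (qform_hessian_F wstar x) _.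
by rewrite mulr_sumr; apply: ler_sum => i _; exact: hessian_G_le.
Qed.

Lemma hessian_F_ge w x : N w ->
  11 / 12 * qform (hessian F wstar) x <= qform (hessian F w) x.
Proof.
have aux (m q q' s s' k : R) : 0 < m -> m * q = s -> m * q' = s' -> k * s' <= s -> k * q' <= q.
  by move=> m0 <- <-; rewrite mulrCA ler_pM2l.
move=> Nw; apply: aux nr (qform_hessian_F w x) (qform_hessian_F wstar x) _.
by rewrite mulr_sumr; apply: ler_sum => i _; exact: hessian_G_ge.
Qed.

Variables (P : 'M[R]_p) (w0 : 'cV[R]_p).
Hypotheses (P_spd : spd P) (Nw0 : N w0).
Hypothesis P_le : loewner_le ((1 - eps0) *: P) (hessian F w0).
Hypothesis P_ge : loewner_le (hessian F w0) ((1 + eps0) *: P).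

Lemma loewner_le_scalel c (A B : 'M[R]_p) x : loewner_le (c *: A) B -> c * qform A x <= qform B x.
Proof. by move=> [_ /(_ x)]; rewrite qformE bform_mxB bform_mxZ subr_ge0. Qed.

Lemma loewner_le_scaler c (A B : 'M[R]_p) x : loewner_le B (c *: A) -> qform B x <= c * qform A x.
Proof. by move=> [_ /(_ x)]; rewrite qformE bform_mxB bform_mxZ subr_ge0. Qed.

(** Both comparisons of [P] with the Hessian at [wstar] pass through [w0]: here
    [14 / 11 = 7 / 6 * (12 / 11)], and for the reverse bound [13 / 10 = 6 / 5 * (13 / 12)]. *)
Lemma hessian_star_le x : qform (hessian F wstar) x <= 14 / 11 * qform P x.
Proof.
have aux (a b c : R) : 0 <= a -> 11 / 12 * c <= b -> b <= (1 + eps0) * a -> c <= 14 / 11 * a.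
  move=> a0 h1 h2; have /andP[_ e6] := eps_range.
  have : eps0 * a <= 1 / 6 * a by rewrite ler_wpM2r.
  lra.
exact: aux (proj2 (spd_psd P_spd) x) (hessian_F_ge x Nw0) (loewner_le_scaler x P_ge).
Qed.

Lemma P_le_hessian_star x : qform P x <= 13 / 10 * qform (hessian F wstar) x.
Proof.
have aux (a b c : R) : 0 <= a -> b <= 13 / 12 * c -> (1 - eps0) * a <= b -> a <= 13 / 10 * c.
  move=> a0 h1 h2; have /andP[_ e6] := eps_range.
  have : eps0 * a <= 1 / 6 * a by rewrite ler_wpM2r.
  lra.
exact: aux (proj2 (spd_psd P_spd) x) (hessian_F_le x Nw0) (loewner_le_scalel x P_le).
Qed.

(* The constants are [11/12 * 10/13] and [13/12 * 14/11], rounded. *)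
Lemma hessian_F_P w x : N w ->
  705 / 1000 * qform P x <= qform (hessian F w) x <= 1379 / 1000 * qform P x.
Proof.
have aux (a b c : R) : 0 <= a -> b <= 13 / 12 * c -> 11 / 12 * c <= b ->
    c <= 14 / 11 * a -> a <= 13 / 10 * c -> 705 / 1000 * a <= b <= 1379 / 1000 * a.
  by move=> *; apply/andP; split; lra.
move=> Nw; exact: aux (proj2 (spd_psd P_spd) x) (hessian_F_le x Nw) (hessian_F_ge x Nw)
  (hessian_star_le x) (P_le_hessian_star x).
Qed.

(** Testing the gradient against [r] itself gives the squared norm of [r] as the form of
    [P - hessian F xi] between [r] and [w - wstar]. By [hessian_F_P] this difference is at most
    [1379 / 1000 - 1] relative to [P]; one factor [wnorm P r] then cancels. *)
Lemma newton_contraction w r : N w ->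
  P *m r = P *m (w - wstar) - gradient F w ->
  wnorm P r <= 379 / 1000 * wnorm P (w - wstar).
Proof.
move=> Nw Pr; have Pp := spd_psd P_spd.
have [c [c0 c1 E]] := grad_MVT twice_differentiable_F wstar w r.
set xi := wstar + c *: (w - wstar) in E.
have Nxi : N xi by apply: nbhd_segment => //; exact: nbhd_wstar.
rewrite (gradient_minimizer twice_differentiable_F wstar_min) subr0 in E.
have q : wnorm P r ^+ 2 = bform (P - hessian F xi) r (w - wstar).
  rewrite (sqr_wnorm _ Pp) bform_mxB -E -(bform1_mulmx P r (w - wstar)) qformE.
  by rewrite -(bform1_mulmx P r r) Pr bformDr bformNr.
have Ps : (P - hessian F xi)^T = P - hessian F xi.
  by rewrite linearB /= hessian_F_sym (proj1 P_spd).
have k0 : 0 <= 379 / 1000 :> R by lra.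
have close z : `|qform (P - hessian F xi) z| <= 379 / 1000 * qform P z.
  have aux (a b : R) : 0 <= a -> 705 / 1000 * a <= b <= 1379 / 1000 * a ->
      `|a - b| <= 379 / 1000 * a.
    by move=> ? /andP[? ?]; rewrite ler_norml; apply/andP; split; lra.
  rewrite qformE bform_mxB.
  exact: aux (proj2 Pp z) (hessian_F_P z Nxi).
have := bform_le_wnorm r (w - wstar) Ps Pp k0 close.
rewrite -q ger0_norm ?sqr_ge0 // expr2 mulrAC.
have [->|r0] := eqVneq (wnorm P r) 0; first by rewrite mulr_ge0 ?wnorm_ge0.
by rewrite ler_pM2r // lt_def r0 wnorm_ge0.
Qed.

(* Subtracting the parabola [a / 2 * s ^+ 2] before applying the mean value theorem keeps the
   factor [1 / 2] of the Taylor expansion. *)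
Lemma suboptimality_bounds w : N w ->
  705 / 2000 * qform P (w - wstar) <= F w - F wstar <= 1379 / 2000 * qform P (w - wstar).
Proof.
move=> Nw; set d := w - wstar; set q := qform P d.
have Dq (a : R) t : is_derive t (1 : R) (fun s : R => F (wstar + s *: d) - a / 2 * s ^+ 2)
    (bform 1%:M d (gradient F (wstar + t *: d)) - a * t).
  apply: is_deriveB; first exact: (is_derive_line_grad twice_differentiable_F).
  rewrite (_ : (fun s : R => _) = (a / 2) \*: (@id R * @id R)); last first.
    by apply/funext => s; rewrite expr2.
  apply: is_derive_eq.
  by rewrite /GRing.scale /=; field.
have key a : exists c b, [/\ 0 < c, N (wstar + b *: d) &
    F w - F wstar - a / 2 = c * (qform (hessian F (wstar + b *: d)) d - a)].
  have [c [c0 c1]] := MVT_line ltr01 (Dq a).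
  rewrite scale1r scale0r addr0 subr0 mulr1 expr1n mulr1 expr0n /= mulr0 subr0.
  rewrite [wstar + _]addrC subrK => E.
  have [b [b0 bc]] := MVT_line c0 (is_derive_line_hess twice_differentiable_F wstar d d).
  rewrite scale0r addr0 (gradient_minimizer twice_differentiable_F wstar_min) bform0r !subr0 => E2.
  exists c, b; split=> //; last first.
    by move: E; rewrite E2 -qformE; move: (qform _ _) => h; lra.
  by apply: nbhd_segment => //; [exact: nbhd_wstar | exact: ltW | lra].
have aux (a gap c h : R) : 0 < c -> gap - a / 2 = c * (h - a) ->
    (a <= h -> a / 2 <= gap) /\ (h <= a -> gap <= a / 2).
  move=> c0 E; split=> ha; first by rewrite -subr_ge0 E mulr_ge0 ?(ltW c0) ?subr_ge0.
  by rewrite -subr_le0 E mulr_ge0_le0 ?(ltW c0) ?subr_le0.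
have half (k : R) : k / 2000 * q = k / 1000 * q / 2 by field.
rewrite (half 705) (half 1379); apply/andP; split.
  have [c [b [c0 Nb E]]] := key (705 / 1000 * q).
  by apply: (proj1 (aux _ _ _ _ c0 E)); have /andP[] := hessian_F_P d Nb.
have [c [b [c0 Nb E]]] := key (1379 / 1000 * q).
by apply: (proj2 (aux _ _ _ _ c0 E)); have /andP[] := hessian_F_P d Nb.
Qed.

Variable tau : R.
Hypothesis tau_ge1 : 1 <= tau.
Hypothesis tau_star : forall i x,
  qform (hessian (G i) wstar) x <= tau * qform (hessian F wstar) x.

Definition precond_diff (what w : 'cV[R]_p) (i : 'I_n) : 'cV[R]_p :=
  invmx P *m (gradient (G i) w - gradient (G i) what).

Definition precond_dev (what w : 'cV[R]_p) (i : 'I_n) : 'cV[R]_p :=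
  precond_diff what w i - invmx P *m (gradient F w - gradient F what).

Lemma precond_diff_mean what w :
  \sum_i precond_diff what w i = n%:R *: (invmx P *m (gradient F w - gradient F what)).
Proof.
rewrite -mulmx_sumr scalemxAr sumrB !gradient_average // -scalerBr scalerA.
by rewrite mulfV ?gt_eqF // scale1r.
Qed.

Lemma precond_dev_sum0 what w : \sum_i precond_dev what w i = 0.
Proof.
by rewrite sumrB precond_diff_mean sumr_const card_ord scaler_nat subrr.
Qed.

(** Cauchy-Schwarz in the Hessian of [G i] at the intermediate point produces that form at [u] and
    at [w - what]. Only the first is compared with [P], at the cost of [tau]; the second is kept so
    that summing over [i] costs no further [tau]. The constant rounds up
    [13 / 12 * (14 / 11) * (13 / 12)]. *)
Lemma qform_precond_diff what w i : N w -> N what ->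
  qform P (precond_diff what w i) <=
  3 / 2 * tau * qform (hessian (G i) wstar) (w - what).
Proof.
have num : 182 / 132 * (13 / 12) <= 3 / 2 :> R by lra.
move=> Nw Nwhat; set u := precond_diff what w i; set d := w - what.
have tau0 : 0 <= tau by apply: le_trans tau_ge1.
have [c [c0 c1 E]] := grad_MVT (G2 i) what w u.
set xi := what + c *: (w - what) in E.
have Nxi : N xi by exact: nbhd_segment.
have q : qform P u = bform (hessian (G i) xi) u d.
  rewrite -E qformE -(bform1_mulmx P u u); congr (bform _ _ _).
  by rewrite /u /precond_diff mulmxA mulmxV ?mul1mx // spd_unitmx.
have CS := psd_CS u d (hessian_G_psd i xi); rewrite -q in CS.
have u0 := proj2 (spd_psd P_spd) u.
have d0 := proj2 (hessian_G_psd i wstar) d.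
have l1 : qform (hessian (G i) xi) u <= 182 / 132 * tau * qform P u.
  apply: le_trans (hessian_G_le i u Nxi) _.
  apply: (@le_trans _ _ (13 / 12 * (tau * (14 / 11 * qform P u)))); last first.
    by rewrite le_eqVlt; apply/orP; left; apply/eqP; field.
  rewrite ler_wpM2l //; apply: le_trans (tau_star i u) _.
  by rewrite ler_wpM2l // hessian_star_le.
have l2 := hessian_G_le i d Nxi.
have [->|uN0] := eqVneq (qform P u) 0; first by rewrite !mulr_ge0.
have {u0} u_gt0 : 0 < qform P u by rewrite lt_def uN0.
rewrite -(ler_pM2r u_gt0) -expr2; apply: le_trans CS _.
apply: le_trans (ler_pM (proj2 (hessian_G_psd i xi) u) (proj2 (hessian_G_psd i xi) d) l1 l2) _.
rewrite [leLHS](_ : _ = 182 / 132 * (13 / 12) *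
  (tau * qform P u * qform (hessian (G i) wstar) d)); last by field.
rewrite [leRHS](_ : _ = 3 / 2 * (tau * qform P u * qform (hessian (G i) wstar) d)); last by field.
by apply: ler_wpM2r; [rewrite !mulr_ge0 // ltW | exact: num].
Qed.

(** Centering only lowers a sum of squares, and the component Hessians left by [qform_precond_diff]
    add up to [n] times that of [F]. The constant rounds up [3 / 2 * (14 / 11) = 21 / 11]. *)
Lemma sum_qform_precond_dev what w : N w -> N what ->
  \sum_i qform P (precond_dev what w i) <=
  n%:R * (2 * tau * wnorm P (w - what) ^+ 2).
Proof.
have num : 21 / 11 <= 2 :> R by lra.
move=> Nw Nwhat; have Pp := spd_psd P_spd; set m := invmx P *m (gradient F w - gradient F what).
have tau0 : 0 <= tau by apply: le_trans tau_ge1.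
have -> : \sum_i qform P (precond_dev what w i) =
    \sum_i qform P (precond_diff what w i) - n%:R * qform P m.
  under eq_bigr => i _ do rewrite /precond_dev -/m qformD ?(proj1 Pp) // qformN bformNr -addrA.
  rewrite big_split /=; congr (_ + _); rewrite big_split /= sumr_const card_ord.
  rewrite -mulr_sumr sumrN -bform_suml precond_diff_mean -/m bformZl -qformE.
  by rewrite -[_ *+ _]mulr_natl; ring.
apply: (@le_trans _ _ (\sum_i qform P (precond_diff what w i))).
  by rewrite gerBl mulr_ge0 // ?(proj2 Pp).
apply: (@le_trans _ _ (\sum_i 3 / 2 * tau * qform (hessian (G i) wstar) (w - what))).
  by apply: ler_sum => i _; exact: qform_precond_diff.
rewrite -mulr_sumr -qform_hessian_F mulrCA ler_wpM2l // (sqr_wnorm _ Pp).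
apply: (@le_trans _ _ (3 / 2 * tau * (14 / 11 * qform P (w - what)))).
  by rewrite ler_wpM2l ?mulr_ge0 // hessian_star_le.
rewrite [leLHS](_ : _ = 21 / 11 * (tau * qform P (w - what))); last by field.
by rewrite -[leRHS]mulrA; apply: ler_wpM2r num; rewrite mulr_ge0 // (proj2 Pp).
Qed.

(** For a single index the remaining component Hessian costs a second [tau], so the norm is of order
    [tau]. The difference and its mean each contribute [3 / 2], as [21 / 11 <= (3 / 2) ^+ 2]. *)
Lemma wnorm_precond_dev what w i : N w -> N what ->
  wnorm P (precond_dev what w i) <= 3 * tau * wnorm P (w - what).
Proof.
have num : 21 / 11 <= 9 / 4 :> R by lra.
move=> Nw Nwhat; have Pp := spd_psd P_spd.
have tau0 : 0 <= tau by apply: le_trans tau_ge1.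
have Y j : wnorm P (precond_diff what w j) <= 3 / 2 * tau * wnorm P (w - what).
  apply: wnorm_le; first by rewrite mulr_ge0.
  apply: le_trans (qform_precond_diff j Nw Nwhat) _.
  apply: (@le_trans _ _ (3 / 2 * tau * (tau * (14 / 11 * qform P (w - what))))).
    rewrite ler_wpM2l ?mulr_ge0 //; apply: le_trans (tau_star _ _) _.
    by rewrite ler_wpM2l // hessian_star_le.
  rewrite [leLHS](_ : _ = 21 / 11 * (tau ^+ 2 * qform P (w - what))); last by field.
  rewrite [leRHS](_ : _ = 9 / 4 * (tau ^+ 2 * qform P (w - what))); last by field.
  by apply: ler_wpM2r num; rewrite mulr_ge0 ?exprn_ge0 // (proj2 Pp).
rewrite /precond_dev; apply: le_trans (wnormD _ _ Pp) _; rewrite wnormN.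
have m : wnorm P (invmx P *m (gradient F w - gradient F what)) <= 3 / 2 * tau * wnorm P (w - what).
  rewrite -(ler_pM2l nr) -[X in X * wnorm _ _ <= _](ger0_norm (ltW nr)) -wnormZ -precond_diff_mean.
  rewrite [leRHS](_ : _ = \sum_(j < n) 3 / 2 * tau * wnorm P (w - what)); last first.
    by rewrite sumr_const card_ord -[RHS]mulr_natl.
  elim/big_ind2 : _ => [|x1 x2 y1 y2 le1 le2|j _]; first by rewrite wnorm0.
    by apply: le_trans (wnormD _ _ Pp) _; exact: lerD.
  exact: Y.
apply: le_trans (lerD (Y i) m) _.
by rewrite -mulrDl -mulrDl (_ : 3 / 2 + 3 / 2 = 3 :> R) //; field.
Qed.

(** [sampling_tail] is applied with threshold, variance and size bound all scaled by [D], and [lam]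
    of order [(tau * D)^-1], so that the exponent depends only on [b / tau]. For the chosen [k] the
    linear gain [7 / 800 * (y / k)] dominates the variance term [16 * (y / k / k)]. *)
Lemma minibatch_tail (b : nat) (l : R) what w : N w -> N what ->
  (0 < b)%N -> (2 * b <= n)%N -> 0 <= l -> 10 * 100 * (10 * 100) * tau * (1 + l) <= b%:R ->
  #|[set B : {set 'I_n} | (#|B| == b) &&
     ~~ (wnorm P (\sum_(i in B) precond_dev what w i) <= b%:R * (wnorm P (w - what) / 100))]%SET|%:R
  <= expR (- l) * 'C(n, b)%:R.
Proof.
move=> Nw Nwhat b0 bn l0 bl; have Pp := spd_psd P_spd.
have tau0 : 0 < tau by apply: lt_le_trans tau_ge1.
set D := wnorm P (w - what).
(* [sampling_tail] requires a positive threshold. When [D = 0] all deviations have norm 0 and no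
   draw is bad. *)
have [D0|DN0] := eqVneq D 0.
  rewrite (_ : finset _ = finset.set0) ?cards0 ?mulr_ge0 ?expR_ge0 //.
  apply/setP => B; rewrite !inE; apply/negbTE; rewrite negb_and negbK; apply/orP; right.
  rewrite D0 mul0r mulr0; elim/big_ind: _ => [|x y x0 y0|i _]; first by rewrite wnorm0.
    by apply: le_trans (wnormD _ _ Pp) _; rewrite -(addr0 0) lerD.
  by apply: le_trans (wnorm_precond_dev i Nw Nwhat) _; rewrite -/D D0 mulr0.
have D_gt0 : 0 < D by rewrite lt_def DN0 wnorm_ge0.
have [k kE k0] : exists2 k : R, k = 32 * 100 & 0 < k by exists (32 * 100); rewrite ?mulr_gt0.
have num (y : R) : 10 * 100 * (10 * 100) * (1 + l) <= y ->
    400 / k - 7 / 800 * (y / k) + 16 * (y / k / k) <= - l.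
  by rewrite kE => yl; lra.
(* [k] only has to be large enough for [num], which absorbs the terms of [sampling_tail]. *)
pose lam := (k * tau * D)^-1.
have lam0 : 0 <= lam by rewrite invr_ge0 mulr_ge0 ?mulr_ge0 ?(ltW k0) ?(ltW tau0) ?(ltW D_gt0).
have tail := @sampling_tail R 'I_n p P (precond_dev what w) Pp (precond_dev_sum0 what w)
  b (2 * tau * D ^+ 2) (D / 100) lam (3 * tau * D) b0.
rewrite card_ord in tail.
rewrite (_ : finset _ = [set B : {set 'I_n} | (#|B| == b) &&
    (b%:R * (D / 100) < wnorm P (\sum_(i in B) precond_dev what w i))]%SET); last first.
  by apply/setP => B; rewrite !inE -ltNge.
apply: le_trans (tail _ _ lam0 _ (fun i => wnorm_precond_dev i Nw Nwhat)
  (sum_qform_precond_dev Nw Nwhat)) _ => //.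
- by rewrite divr_gt0.
- rewrite /lam [leLHS](_ : _ = 24 / k); last by field; rewrite !gt_eqF.
  by rewrite ler_pdivrMr // kE; lra.
apply: ler_wpM2r => //; rewrite ler_expR.
pose y := b%:R / tau.
have yl : 10 * 100 * (10 * 100) * (1 + l) <= y by rewrite /y ler_pdivlMr // mulrAC.
rewrite [leLHS](_ : _ = 400 / k - 7 / 800 * (y / k) + 16 * (y / k / k)); first exact: num.
by rewrite /lam /y; field; rewrite !gt_eqF.
Qed.

(** The update is the exact preconditioned step minus the mean deviation over [B]. The former
    contributes [379 / 1000]. The latter contributes at most [2 / 100], because [w] and [what] are
    each within the snapshot distance of [wstar]; the total [399 / 1000] is below [2 / 5]. *)
Lemma inner_step (b : nat) (B : {set 'I_n}) what w : N w -> (0 < b)%N -> #|B| = b ->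
  wnorm P (\sum_(i in B) precond_dev what w i) <= b%:R * (wnorm P (w - what) / 100) ->
  wnorm P (w - wstar) <= wnorm P (what - wstar) ->
  wnorm P (w - invmx P *m (b%:R^-1 *: (\sum_(i in B) gradient (G i) w)
     - b%:R^-1 *: (\sum_(i in B) gradient (G i) what) + gradient F what) - wstar) <=
  2 / 5 * wnorm P (what - wstar).
Proof.
have aux (t1 t2 t3 t4 t5 : R) : t1 <= t5 / 100 -> t5 <= t3 + t4 ->
    t2 <= 379 / 1000 * t3 -> t3 <= t4 -> 0 <= t4 -> t2 + t1 <= 2 / 5 * t4.
  by move=> *; lra.
move=> Nw b0 cB dev le_what; have Pp := spd_psd P_spd.
have br : 0 < b%:R :> R by rewrite ltr0n.
pose r := (w - wstar) - invmx P *m gradient F w.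
have contr := @newton_contraction w r Nw.
have -> : w - invmx P *m (b%:R^-1 *: (\sum_(i in B) gradient (G i) w)
     - b%:R^-1 *: (\sum_(i in B) gradient (G i) what) + gradient F what) - wstar =
   r - b%:R^-1 *: \sum_(i in B) precond_dev what w i.
  rewrite /precond_dev sumrB sumr_const cB -[(invmx P *m _) *+ b]scaler_nat.
  rewrite [X in _ = _ - X]scalerBr.
  rewrite [X in _ = _ - (_ - X)]scalerA mulVf ?gt_eqF // scale1r.
  rewrite -mulmx_sumr sumrB -scalerBr scalemxAr mulmxDr mulmxBr /r.
  move: (_ *m _) (_ *m _) (_ *m _) => x1 x2 x3.
  by apply/colP => i; rewrite !mxE; ring.
apply: le_trans (wnormD _ _ Pp) _; rewrite wnormN wnormZ ger0_norm ?invr_ge0 ?(ltW br) //.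
have n1 : b%:R^-1 * wnorm P (\sum_(i in B) precond_dev what w i) <= wnorm P (w - what) / 100.
  by rewrite ler_pdivrMl.
have n2 : wnorm P (w - what) <= wnorm P (w - wstar) + wnorm P (what - wstar).
  rewrite -(wnormN P (what - wstar)); apply: le_trans _ (wnormD _ _ Pp).
  by rewrite opprB addrA subrK.
have n3 : wnorm P r <= 379 / 1000 * wnorm P (w - wstar).
  apply: contr; rewrite /r mulmxBr mulmxA mulmxV ?mul1mx //; exact: spd_unitmx.
exact: aux n1 n2 n3 le_what (wnorm_ge0 _ _).
Qed.

(** Contraction is in the [P]-norm but [N] is a ball for the Hessian at [wstar]. The squared factor
    [4 / 25] outweighs the distortion [14 / 11 * (13 / 10)] of changing norm and back. *)
Lemma nbhd_contracted w : wnorm P (w - wstar) <= 2 / 5 * wnorm P (w0 - wstar) -> N w.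
Proof.
have aux (h a a0 h0 : R) : h <= 14 / 11 * a -> a <= 4 / 25 * a0 -> a0 <= 13 / 10 * h0 ->
    0 <= h0 -> h <= 1 ^+ 2 * h0.
  by move=> *; lra.
have Pp := spd_psd P_spd => H; rewrite /local_nbhd /=; apply: le_trans Nw0.
rewrite -[leRHS]mul1r; apply: wnorm_le => //.
have a : qform P (w - wstar) <= 4 / 25 * qform P (w0 - wstar).
  rewrite -!(sqr_wnorm _ Pp) (_ : 4 / 25 = (2 / 5) ^+ 2 :> R); last by field.
  by rewrite -exprMn ler_sqr ?nnegrE ?mulr_ge0 ?wnorm_ge0.
exact: aux (hessian_star_le _) a (P_le_hessian_star _) (proj2 (spd_psd (hessian_F_spd wstar)) _).
Qed.

Definition svrg_update (b : nat) (B : {set 'I_n}) (what w : 'cV[R]_p) : 'cV[R]_p :=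
  w - invmx P *m (b%:R^-1 *: (\sum_(i in B) gradient (G i) w)
     - b%:R^-1 *: (\sum_(i in B) gradient (G i) what) + gradient F what).

Definition small_noise (b : nat) (B : {set 'I_n}) (what w : 'cV[R]_p) : bool :=
  wnorm P (\sum_(i in B) precond_dev what w i) <= b%:R * (wnorm P (w - what) / 100).

(** The noise hypothesis is conditional on [N (x k)], which the induction supplies from the previous
    contraction. The factor stays at [2 / 5] for all positive [k], since the bound on the noise
    involves the distance of the fixed snapshot. *)
Lemma inner_loop (b m : nat) (Bs : nat -> {set 'I_n}) (x : nat -> 'cV[R]_p) :
  (0 < b)%N -> N (x 0%N) -> wnorm P (x 0%N - wstar) <= wnorm P (w0 - wstar) ->
  (forall k, (k < m)%N -> [/\ #|Bs k| = b, x k.+1 = svrg_update b (Bs k) (x 0%N) (x k)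
     & N (x k) -> small_noise b (Bs k) (x 0%N) (x k)]) ->
  forall k, (k <= m)%N -> [/\ N (x k), wnorm P (x k - wstar) <= wnorm P (x 0%N - wstar) &
    (0 < k)%N -> wnorm P (x k - wstar) <= 2 / 5 * wnorm P (x 0%N - wstar)].
Proof.
move=> b0 N0 D0 H; elim=> [|k IHk] km; first by split.
have [Nk lek _] := IHk (ltnW km); have [cB xE noise] := H k km.
have step : wnorm P (x k.+1 - wstar) <= 2 / 5 * wnorm P (x 0%N - wstar).
  by rewrite xE; apply: inner_step => //; exact: noise.
split=> //.
  by apply: nbhd_contracted; apply: le_trans step _; rewrite ler_wpM2l.
apply: le_trans step _; rewrite -[leRHS]mul1r ler_wpM2r ?wnorm_ge0 //.
by rewrite ler_pdivrMr // mul1r ler_nat.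
Qed.

Lemma outer_loop (b m s : nat) (y : nat -> 'cV[R]_p) :
  (0 < b)%N -> (0 < m)%N -> y 0%N = w0 ->
  (forall j, (j < s)%N -> exists (Bs : nat -> {set 'I_n}) (x : nat -> 'cV[R]_p),
    [/\ x 0%N = y j, x m = y j.+1 &
     forall k, (k < m)%N -> [/\ #|Bs k| = b, x k.+1 = svrg_update b (Bs k) (x 0%N) (x k)
     & N (x k) -> N (y j) -> small_noise b (Bs k) (x 0%N) (x k)]]) ->
  forall j, (j <= s)%N ->
    N (y j) /\ wnorm P (y j - wstar) <= (2 / 5) ^+ j * wnorm P (w0 - wstar).
Proof.
move=> b0 m0 y0 H; elim=> [|j IHj] js; first by rewrite y0 expr0 mul1r.
have [Nj lej] := IHj (ltnW js).
have [Bs [x [x0 xm Hx]]] := H j js.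
have r1 : 2 / 5 <= 1 :> R by rewrite ler_pdivrMr // mul1r ler_nat.
have le0 : wnorm P (x 0%N - wstar) <= wnorm P (w0 - wstar).
  rewrite x0; apply: le_trans lej _; rewrite -[leRHS]mul1r ler_wpM2r ?wnorm_ge0 //.
  by rewrite exprn_ile1.
have [|k km|Nm _ /(_ m0) lem] := @inner_loop b m Bs x b0 _ le0 _ m (leqnn m).
- by rewrite x0.
- by have [? ? noise] := Hx k km; split=> // Nk; apply: noise.
rewrite -xm; split=> //; apply: le_trans lem _.
by rewrite x0 exprS -[leRHS]mulrA ler_wpM2l.
Qed.

(** Passing between the [P]-norm and [F] costs [1379 / 705] once. Writing [4 / 25] as
    [12 / 25 * 3^-1], a single factor [12 / 25] absorbs that cost, whence [0 < s]. *)
Lemma suboptimality_contracted s w : (0 < s)%N -> N w ->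
  wnorm P (w - wstar) <= (2 / 5) ^+ s * wnorm P (w0 - wstar) ->
  F w - F wstar <= 3^-1 ^+ s * (F w0 - F wstar).
Proof.
have Pp := spd_psd P_spd.
have aux (g g0 a a0 r t : R) : g <= 1379 / 2000 * a -> 705 / 2000 * a0 <= g0 ->
    a <= r * a0 -> 0 <= r -> 0 <= g0 -> 1379 / 705 * r <= t -> g <= t * g0.
  move=> h1 h2 h3 r0 g00 rt.
  have h4 : r * a0 <= r * (2000 / 705 * g0) by rewrite ler_wpM2l //; lra.
  have h5 : 1379 / 705 * r * g0 <= t * g0 by rewrite ler_wpM2r.
  have k0 : 0 <= 1379 / 2000 :> R by lra.
  have h6 := ler_wpM2l k0 (le_trans h3 h4).
  have E : 1379 / 2000 * (r * (2000 / 705 * g0)) = 1379 / 705 * r * g0 by field.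
  by rewrite E in h6; apply: le_trans h1 (le_trans h6 h5).
have num : 1379 / 705 * (12 / 25) <= 1 :> R by lra.
have pow (a k r : R) : 0 <= a <= 1 -> 0 <= k -> 0 <= r -> k * a <= 1 ->
    forall m, k * (a * r) ^+ m.+1 <= r ^+ m.+1.
  move=> /andP[a0 a1] k0 r0 ka m; rewrite exprMn mulrA.
  apply: ler_piMl; first exact: exprn_ge0.
  by rewrite exprS mulrA (le_trans (ler_piMr _ (exprn_ile1 _ a0 a1))) ?mulr_ge0.
have p1 : 0 <= (12 / 25 : R) <= 1 by apply/andP; split; lra.
have p2 : 0 <= 1379 / 705 :> R by lra.
have p3 : 0 <= 3^-1 :> R by lra.
case: s => // s _ Nw le.
have /andP[_ h1] := suboptimality_bounds Nw.
have /andP[h2 _] := suboptimality_bounds Nw0.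
apply: (aux _ _ _ _ ((4 / 25) ^+ s.+1) _ h1 h2).
- rewrite -!(sqr_wnorm _ Pp) (_ : 4 / 25 = (2 / 5) ^+ 2 :> R); last by field.
  by rewrite exprAC -exprMn ler_sqr ?nnegrE ?mulr_ge0 ?exprn_ge0 ?wnorm_ge0.
- by rewrite exprn_ge0.
- by rewrite subr_ge0; exact: wstar_min.
- rewrite (_ : 4 / 25 = 12 / 25 * 3^-1 :> R); last by field.
  exact: (pow _ _ _ p1 p2 p3 num).
Qed.

End LocalAnalysis.

(** * Numerical constants, rounding of the iteration count and choice of the batch size *)

Section Numerics.
Context {R : realType}.

Lemma expR1_le3 : expR 1 <= 3 :> R.
Proof.
have e4 : expR (4^-1) <= 21 / 16 :> R.
  by apply: le_trans (expR_le_quadratic (lexx _)) _; lra.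
have -> : expR 1 = expR (4^-1) ^+ 4 :> R by rewrite -expRM_natl; congr expR; field.
apply: (@le_trans _ _ ((21 / 16) ^+ 4)); last by lra.
by rewrite lerXn2r ?nnegrE ?expR_ge0 //; lra.
Qed.

(** Write [2 / 3] as [8 / 12] and square the bound on [expR (12^-1)] three times; the upward
    roundings are fine enough to end at 2. *)
Lemma ln2_ge : 2 / 3 <= ln 2 :> R.
Proof.
have e12 : expR (12^-1) <= 157 / 144 :> R.
  by apply: le_trans (expR_le_quadratic _) _; lra.
rewrite -ler_expR lnK ?posrE //.
have -> : expR (2 / 3) = ((expR (12^-1) ^+ 2) ^+ 2) ^+ 2 :> R.
  by rewrite -!exprM -expRM_natl; congr expR; field.
have sq (a b c : R) : 0 <= a -> a <= b -> b * b <= c -> a ^+ 2 <= c.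
  by move=> a0 ab; apply: le_trans; rewrite expr2 ler_pM.
have e6 : expR (12^-1) ^+ 2 <= 1189 / 1000 :> R.
  by apply: sq e12 _; [exact: expR_ge0 | lra].
have e3 : (expR (12^-1) ^+ 2) ^+ 2 <= 707 / 500 :> R.
  by apply: sq e6 _; [rewrite exprn_ge0 ?expR_ge0 | lra].
by apply: sq e3 _; [rewrite !exprn_ge0 ?expR_ge0 | lra].
Qed.

Lemma ceil_double_bounds (x : R) (s := `|Num.ceil (2 * x)|%N) : 0 < x ->
  [/\ (0 < s)%N, 2 * x <= s%:R & s%:R < 2 * x + 1].
Proof.
move=> x0; have x2 : 0 < 2 * x by rewrite mulr_gt0.
have c0 : 0 < Num.ceil (2 * x) by rewrite -(ltr_int R) (lt_le_trans x2) // ceil_ge.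
have sE : s%:R = (Num.ceil (2 * x))%:~R :> R by rewrite natr_absz gtr0_norm.
split; first by rewrite absz_gt0 gt_eqF.
  by rewrite sE ceil_ge.
by rewrite sE -ltrBlDr; have /andP[] := ceil_itv (2 * x); rewrite intrD.
Qed.

(** For [1 <= x] rounding up costs at most [x]. Below 1 the integer is at most 2, and [2 <= 3 * x]
    is the assumption on [x]. *)
Lemma ceil_double_le (x : R) : 2 / 3 <= x -> `|Num.ceil (2 * x)|%N%:R <= 3 * x.
Proof.
move=> x23; have x0 : 0 < x by lra.
have [s0 _ s1] := ceil_double_bounds x0.
set s := absz _ in s0 s1 *.
have [x1|x1] := lerP 1 x; first by lra.
suff : (s <= 2)%N by rewrite -(ler_nat R); lra.
by rewrite -ltnS -(ltr_nat R); lra.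
Qed.

(* [48 = 4 * 12]: truncation of [bound / 2] loses a factor 4, and
   [1 + ln (6 s / delta) <= 12 * (1 + ln delta^-1) * (1 + ln (1 + x))]. *)
Lemma batch_size_exists (n : nat) (tau delta eps : R) (x := ln eps^-1)
    (s := `|Num.ceil (2 * x)|%N)
    (bound := 48 * (10 * 100 * (10 * 100)) * batch_order tau delta eps) :
  (0 < n)%N -> 1 <= tau -> 0 < eps < 1 -> 0 < delta < 1 ->
  exists bg : nat, [/\ (0 < bg <= n)%N, bg%:R <= bound & bg = n \/ (2 * bg <= n)%N /\
    exists l, [/\ 0 <= l, expR (- l) = delta / (6 * s)%:R &
      10 * 100 * (10 * 100) * tau * (1 + l) <= bg%:R]].
Proof.
move=> n0 tau1 /andP[eps0 eps1] /andP[d0 d1].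
have x0 : 0 < x by rewrite ln_gt0 // invf_gt1.
have [s0 s1 s2] := ceil_double_bounds x0; rewrite -/s in s0 s1 s2.
have ld : 0 < ln delta^-1 by rewrite ln_gt0 // invf_gt1.
have lx : 0 < ln (1 + x) by rewrite ln_gt0 // ltrDl.
pose AQ := (1 + ln delta^-1) * (1 + ln (1 + x)).
have AQ1 : 1 + ln delta^-1 + ln (1 + x) <= AQ.
  have : 0 <= ln delta^-1 * ln (1 + x) by rewrite mulr_ge0 // ltW.
  by rewrite /AQ; lra.
have sr : 0 < s%:R :> R by rewrite ltr0n.
pose l := ln (6 * s)%:R + ln delta^-1.
have l0 : 0 <= l.
  by apply: addr_ge0; [rewrite ln_ge0 // ler1n muln_gt0 | exact: ltW].
have lE : expR (- l) = delta / (6 * s)%:R.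
  rewrite /l opprD expRD !expRN !lnK ?posrE ?invr_gt0 ?ltr0n ?muln_gt0 //.
  by rewrite invrK mulrC.
have l12 : 1 + l <= 12 * AQ.
  (* From [s < 2 * x + 1] one gets [6 * s <= 12 * (1 + x)], and [ln 12 <= 11] is the crude
     [ln (1 + y) <= y]. *)
  have : ln (6 * s)%:R <= 11 + ln (1 + x).
    have e12 : ln 12 <= 11 :> R.
      by rewrite (_ : 12 = 1 + 11) ?le_ln1Dx //; lra.
    apply: (@le_trans _ _ (ln (12 * (1 + x)))).
      rewrite ler_ln ?posrE ?ltr0n ?muln_gt0 //; last by lra.
      by rewrite natrM; lra.
    by rewrite lnM ?posrE ?lerD2r //; lra.
  by move: AQ1; rewrite /l; lra.
set k6 : R := 10 * 100 * (10 * 100) in bound *.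
have k60 : 1 <= k6 by rewrite /k6; lra.
have boundE : bound = 48 * k6 * tau * AQ by rewrite /bound /batch_order /AQ -/x; ring.
clearbody k6.
have kt : 1 <= k6 * tau by rewrite -[leLHS]mul1r ler_pM.
have AQ2 : 1 <= AQ by lra.
have kAQ : 1 <= k6 * tau * AQ by rewrite -[leLHS]mul1r ler_pM.
have bound4 : 48 <= bound by rewrite boundE; move: kAQ; clear; lra.
have [nb|bn] := lerP n%:R bound.
  by exists n; split; [rewrite n0 leqnn | | left].
have half0 : 0 <= bound / 2 by lra.
(* Halving ensures [2 * bg <= bound < n], as the sampling bound demands. *)
have /andP[t1 t2] := truncn_itv half0; set bg := Num.truncn _ in t1 t2.
exists bg; split.
- apply/andP; split; first by rewrite truncn_gt0; lra.
  by rewrite -(ler_nat R); lra.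
- by lra.
right; split; first by rewrite -(ler_nat R) natrM; lra.
exists l; split=> //.
apply: (@le_trans _ _ (bound / 4)); last by move: t2; rewrite -[X in _ < X]natr1; lra.
apply: (@le_trans _ _ (k6 * tau * (12 * AQ))); first exact: ler_wpM2l (le_trans ler01 kt) _ _ l12.
by rewrite boundE; lra.
Qed.

End Numerics.

Section Trajectories.
Context {R : realType} {p n : nat}.
Variables (nu : R) (f : 'I_n -> 'cV[R]_p -> R) (b m : nat).
Variables (precond : nat -> 'cV[R]_p -> 'M[R]_p) (w0 : 'cV[R]_p).
Implicit Types (Bs : nat -> {set 'I_n}) (what : 'cV[R]_p) (Q : 'M[R]_p).

Notation P := (precond 0%N w0).
Notation inner := (svrg_inner nu f b (pred1 0%N) precond 1).
Notation outer Bs := (svrg_outer nu f b (pred1 0%N) precond 1 m Bs w0).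

(** Causality: it identifies the iterate computed from a prefix of the draws with that of the full
    run. *)
Lemma svrg_inner_ext Bs Bs' what t0 Q k :
  (forall t, (t < t0 + k)%N -> Bs t = Bs' t) ->
  inner Bs what t0 Q k = inner Bs' what t0 Q k.
Proof.
elim: k => //= k IHk BB; rewrite IHk ?BB ?addnS // => t tk.
by rewrite BB // addnS ltnW.
Qed.

Lemma svrg_outer_ext Bs Bs' j : (forall t, (t < m * j)%N -> Bs t = Bs' t) ->
  outer Bs j = outer Bs' j.
Proof.
elim: j => //= j IHj BB; rewrite IHj => [|t tj]; last first.
  by rewrite BB // (leq_trans tj) // leq_mul2l leqnSn orbT.
by apply: svrg_inner_ext => t tj; rewrite BB // mulnS addnC.
Qed.

(** Either the loop starts at counter 0, and its first step builds the preconditioner at [w0], or it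
    inherits [P]. Positivity of [t0 + k] excludes the initial placeholder matrix. *)
Lemma svrg_inner_precond Bs what t0 Q k : (t0 = 0%N -> what = w0) ->
  ((0 < t0)%N -> Q = P) -> (0 < t0 + k)%N -> (inner Bs what t0 Q k).2 = P.
Proof.
move=> what0 QP; elim: k => [|k IHk]; first by rewrite addn0 => /QP.
move=> _ /=; case: eqP => [/eqP|/eqP t0k].
  by rewrite addn_eq0 => /andP[/eqP t00 /eqP ->]; rewrite t00 what0.
by rewrite IHk // lt0n.
Qed.

Lemma svrg_outer_precond Bs j : (0 < m)%N -> (0 < j)%N -> (outer Bs j).2 = P.
Proof.
move=> m0; elim: j => // j IHj _ /=.
apply: svrg_inner_precond; last by rewrite addn_gt0 m0 orbT.
  by move/eqP; rewrite muln_eq0 -[m == _]negbK -lt0n m0 => /eqP ->.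
by rewrite muln_gt0 m0; exact: IHj.
Qed.

Hypothesis f2 : forall i, twice_differentiable (f i).

Lemma minibatch_gradientE (B : {set 'I_n}) w : (0 < b)%N -> #|B| = b ->
  minibatch_gradient nu f b B w =
  b%:R^-1 *: (\sum_(i in B) gradient (regularized nu (f i)) w).
Proof.
move=> b0 cB; rewrite /minibatch_gradient.
under [in RHS]eq_bigr => i _ do rewrite gradient_regularized //.
rewrite big_split /= sumr_const cB -[(nu *: w) *+ b]scaler_nat [RHS]scalerDr.
rewrite [X in _ = _ + X]scalerA.
by rewrite mulVf ?scale1r // pnatr_eq0 -lt0n.
Qed.

Lemma svrg_inner_step Bs what t0 Q k : (t0 = 0%N -> what = w0) ->
  ((0 < t0)%N -> Q = P) -> (0 < b)%N -> #|Bs (t0 + k)%N| = b ->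
  (inner Bs what t0 Q k.+1).1 =
  svrg_update (fun i => regularized nu (f i)) P b (Bs (t0 + k)%N) what
    (inner Bs what t0 Q k).1.
Proof.
move=> what0 QP b0 cB; rewrite /= /svrg_step !minibatch_gradientE // scale1r.
congr (_ - invmx _ *m _); case: eqP => [/eqP|/eqP t0k].
  by rewrite addn_eq0 => /andP[/eqP t00 /eqP ->]; rewrite t00 what0.
by rewrite svrg_inner_precond // lt0n.
Qed.

End Trajectories.

(** * Transfer of the hypotheses on [f] to the regularized components *)

Section Regularized.
#[local] Opaque hessian gradient qform bform.
Context {R : realType} {p n : nat}.
Variables (nu M : R) (f : 'I_n -> 'cV[R]_p -> R).
Hypotheses (n0 : (0 < n)%N) (nu0 : 0 < nu).
Hypothesis f2 : forall i, twice_differentiable (f i).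
Hypothesis f_convex : forall i, convex_function [set: 'cV[R]_p] (f i).
Hypothesis fM : forall i, lipschitz_hessian M (regularized nu (f i)).

(** The shift [nu%:M] cancels in differences of Hessians, so [f i] inherits the Lipschitz bound of
    its regularization. *)
Lemma hessian_component_psd i w : psd (hessian (f i) w).
Proof.
apply: (hessian_psd_of_convex (f2 i) (M := M)) (f_convex i) => x y.
have E (U V W : 'M[R]_p) : U + W - (V + W) = U - V.
  by rewrite opprD addrACA subrr addr0.
by have := fM i x y; rewrite !hessian_regularized // E.
Qed.

Lemma hessian_regularized_ge i w x :
  nu * qform 1%:M x <= qform (hessian (regularized nu (f i)) w) x.
Proof.
rewrite hessian_regularized // [qform (_ + _) x]bform_mxD bform_scalar lerDr.
exact: (proj2 (hessian_component_psd i w)).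
Qed.

Lemma hessian_objective w :
  hessian (average f) w + nu%:M = hessian (objective nu f) w.
Proof.
rewrite !hessian_average // => [|i]; last exact: twice_differentiable_regularized.
under [in RHS]eq_bigr => i _ do rewrite hessian_regularized //.
rewrite big_split /= sumr_const card_ord -[nu%:M *+ n]scaler_nat [RHS]scalerDr.
rewrite [X in _ = _ + X]scalerA.
by rewrite mulVf ?scale1r // pnatr_eq0 -lt0n.
Qed.

Let r2 i : twice_differentiable (regularized nu (f i)).
Proof. exact: twice_differentiable_regularized. Qed.

Let H_psd i w : psd (hessian (f i) w + nu%:M).
Proof.
by rewrite -hessian_regularized //; exact: (hessian_G_psd nu0 r2 fM hessian_regularized_ge).
Qed.

Let Hbar_spd w : spd (hessian (average f) w + nu%:M).
Proof.
rewrite hessian_objective //; exact: (hessian_F_spd n0 nu0 r2 fM hessian_regularized_ge).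
Qed.

Let HbarE w : hessian (average f) w + nu%:M = n%:R^-1 *: \sum_i (hessian (f i) w + nu%:M).
Proof.
apply: etrans (hessian_objective w) _; apply: etrans (hessian_average w r2) _.
congr (_ *: _); by apply: eq_bigr => i _; rewrite hessian_regularized.
Qed.

Lemma regularized_dissimilarity (C : set 'cV[R]_p) w : C w -> (0 < p)%N ->
  1 <= dissimilarity nu f C /\ forall i x,
    qform (hessian (regularized nu (f i)) w) x <=
    dissimilarity nu f C * qform (hessian (objective nu f) w) x.
Proof.
move=> Cw p0; split; first exact: (dissimilarity_ge1 n0 H_psd Hbar_spd HbarE Cw p0).
move=> i x; rewrite hessian_regularized // -hessian_objective //.
exact: (qform_le_dissimilarity n0 H_psd Hbar_spd HbarE).
Qed.

End Regularized.

Theorem theorem20 (R : realType) :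
  exists K : R, 0 < K /\
  forall (n p : nat) (nu M eps0 eps delta : R)
         (f : 'I_n -> 'cV[R]_p -> R) (L : 'I_n -> R) (wstar : 'cV[R]_p),
  (0 < n)%N -> (0 < p)%N ->
  0 < nu -> 0 < M -> 0 < eps0 <= 1 / 6 -> 0 < eps < 1 -> 0 < delta < 1 ->
  (forall i, twice_differentiable (f i)) ->
  (forall i, convex_function [set: 'cV[R]_p] (f i)) ->
  (forall i, smooth (L i) (f i)) ->
  (forall i, lipschitz_hessian M (regularized nu (f i))) ->
  is_minimizer (objective nu f) wstar ->
  let F := objective nu f in
  let N := local_nbhd F nu M eps0 wstar in
  let s := `|Num.ceil (2 * ln eps^-1)|%N in
  let bound := K * batch_order (dissimilarity nu f N) delta eps in
  exists bg : nat,
    (0 < bg <= n)%N /\ bg%:R <= bound /\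
    forall (w0 : 'cV[R]_p) (precond : nat -> 'cV[R]_p -> 'M[R]_p),
    N w0 ->
    eps * (F w0 - F wstar) <= 1 ->
    spd (precond 0%N w0) ->
    loewner_le ((1 - eps0) *: precond 0%N w0) (hessian F w0) ->
    loewner_le (hessian F w0) ((1 + eps0) *: precond 0%N w0) ->
    1 - delta <=
      finite_uniform_prob R (minibatch_runs n bg (6 * s))
        (fun om => F (sketchy_svrg nu f bg (pred1 0%N) precond 1 6
                        (nth finset.set0 om) w0 s) - F wstar <= eps) /\
    (eps <= 1 / 2 ->
      (svrg_queries n bg 6 s)%:R <= 3 * (n%:R + 6 * bound) * ln eps^-1).
Proof.
exists (48 * (10 * 100 * (10 * 100))); split; first by rewrite !mulr_gt0.
move=> n p nu M eps0 eps delta f L wstar n0 p0 nu0 M0 eps0_range eps_range delta_range.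
move=> f2 f_convex _ fM wstar_min F N s bound.
pose G i := regularized nu (f i).
have G2 i : twice_differentiable (G i) by exact: twice_differentiable_regularized.
have Gnu := hessian_regularized_ge f2 f_convex fM.
have Nstar : N wstar by exact: nbhd_wstar.
(* The supremum over [N] is specialised to [wstar]; [hessian_G_close] relates the other points of
   [N] to it. *)
have [tau1 tau_star] := regularized_dissimilarity n0 nu0 f2 f_convex fM Nstar p0.
have [bg [/andP[bg0 bgn] bg_le bg_cases]] :=
  batch_size_exists n0 tau1 eps_range delta_range.
exists bg; split; first by rewrite bg0.
split; first exact: bg_le.
move=> w0 precond Nw0 gap0 P_spd P_le P_ge.
have /andP[e0 e1] := eps_range; have /andP[d0 d1] := delta_range.
set x := ln eps^-1 in s *.
have x0 : 0 < x by rewrite ln_gt0 // invf_gt1.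
have [s0 s1 s2] := ceil_double_bounds x0; rewrite -/s in s0 s1 s2.
split; last first.
  move=> eps_half; have x23 : 2 / 3 <= x.
    apply: le_trans ln2_ge _; rewrite ler_ln ?posrE ?invr_gt0 //.
    by rewrite -[leLHS]invrK lef_pV2 ?posrE ?invr_gt0 // -[2^-1]mul1r.
  have s3 := ceil_double_le x23; rewrite -/s in s3.
  have aux (S N' b B y : R) : 0 <= S -> S <= 3 * y -> 0 <= N' -> 0 <= b -> b <= B ->
      S * (N' + 6 * b) <= 3 * (N' + 6 * B) * y.
    move=> S0 Sy N0 b0 bB.
    rewrite [leRHS](_ : _ = 3 * y * (N' + 6 * B)); last by ring.
    by apply: ler_pM => //; [rewrite addr_ge0 ?mulr_ge0 | rewrite lerD2l ler_pM2l].
  by rewrite /svrg_queries natrM natrD natrM; exact: aux.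
pose P := precond 0%N w0.
pose out Bs j := svrg_outer nu f bg (pred1 0%N) precond 1 6 Bs w0 j.
pose inn Bs what t0 Q k := svrg_inner nu f bg (pred1 0%N) precond 1 Bs what t0 Q k.
(* With 6 inner steps per loop, counter [t] is at position [t %% 6] of outer iteration [t %/ 6];
   these are its snapshot and its iterate. *)
pose whatof Bs t := (out Bs (t %/ 6)%N).1.
pose wof Bs t := (inn Bs (whatof Bs t) (6 * (t %/ 6))%N (out Bs (t %/ 6)%N).2 (t %% 6)%N).1.
(* The first two alternatives make every draw good once the run has left [N], so that [bad_draws]
   holds for all prefixes; [outer_loop] later rules them out. The default set given by [nth] beyond
   [pre] is harmless, as the iterate at counter [size pre] depends only on earlier draws. *)
pose good (pre : seq {set 'I_n}) B :=
  let Bs := nth finset.set0 pre in let t := size pre in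
  [|| ~~ `[< N (wof Bs t) >], ~~ `[< N (whatof Bs t) >] |
      small_noise G P bg B (whatof Bs t) (wof Bs t)].
pose q := delta / (6 * s)%:R.
have s6 : (0 < 6 * s)%N by rewrite muln_gt0.
have s6r : 0 < (6 * s)%:R :> R by rewrite ltr0n.
have q0 : 0 <= q by rewrite divr_ge0 // ltW.
have q1 : q <= 1.
  by rewrite ler_pdivrMr // mul1r (le_trans (ltW d1)) // ler1n.
have bad_draws pre :
    #|[set B : {set 'I_n} | (#|B| == bg) && ~~ good pre B]%SET|%:R <= q * 'C(n, bg)%:R.
  set Bs := nth finset.set0 pre; set t := size pre.
  have none : (forall B : {set 'I_n}, #|B| = bg -> good pre B) ->
      #|[set B : {set 'I_n} | (#|B| == bg) && ~~ good pre B]%SET|%:R <= q * 'C(n, bg)%:R.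
    move=> all_good.
    have -> : [set B : {set 'I_n} | (#|B| == bg) && ~~ good pre B]%SET = finset.set0.
      apply/finset.setP => B; rewrite !inE; apply/negbTE; rewrite negb_and negbK.
      by case: eqP => //= cB; exact: all_good.
    by rewrite cards0 mulr_ge0.
  case: (asboolP (N (wof Bs t))) => [Nw|nNw]; last first.
    by apply: none => B _; rewrite /good -/Bs -/t asboolF.
  case: (asboolP (N (whatof Bs t))) => [Nwhat|nNwhat]; last first.
    by apply: none => B _; rewrite /good -/Bs -/t [`[< N (whatof _ _) >]]asboolF ?orbT.
  have goodE B : good pre B = small_noise G P bg B (whatof Bs t) (wof Bs t).
    by rewrite /good -/Bs -/t !asboolT.
  case: bg_cases => [bgE|[bg2 [l [l0 lE bgl]]]].
    apply: none => B cB; rewrite goodE.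
    have -> : B = finset.setT.
      by apply/eqP; rewrite finset.eqEcard finset.subsetT finset.cardsT card_ord cB bgE leqnn.
    rewrite /small_noise (eq_bigl xpredT) => [|i]; last by rewrite finset.in_setT.
    rewrite precond_dev_sum0 // wnorm0.
    by rewrite mulr_ge0 // divr_ge0 // wnorm_ge0.
  rewrite /q -lE.
  have tail := minibatch_tail n0 nu0 M0 eps0_range G2 fM Gnu P_spd Nw0 P_ge tau1 tau_star
    Nw Nwhat bg0 bg2 l0 bgl.
  apply: le_trans tail; rewrite ler_nat subset_leq_card //; apply/fintype.subsetP => B.
  by rewrite !inE goodE.
have -> : 1 - delta = 1 - (6 * s)%:R * q by rewrite /q mulrC divfK // gt_eqF.
apply: (prob_good_runs (good := good)) => //; first by rewrite q0 q1.
move=> om om_size om_good; set Bs := nth finset.set0 om.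
have sz t : (t < 6 * s)%N -> #|Bs t| = bg.
  by move=> ts; apply/eqP; move/all_nthP: om_size; apply; rewrite size_tuple.
have run_ext t t' : (t' <= t)%N -> (t <= 6 * s)%N ->
    forall i, (i < t')%N -> nth finset.set0 (take t om) i = Bs i.
  by move=> t't ts i it; rewrite nth_take // (leq_trans it).
have noise j k : (j < s)%N -> (k < 6)%N ->
    N (inn Bs (out Bs j).1 (6 * j) (out Bs j).2 k).1 -> N (out Bs j).1 ->
    small_noise G P bg (Bs (6 * j + k)%N) (out Bs j).1
      (inn Bs (out Bs j).1 (6 * j) (out Bs j).2 k).1.
  move=> js k6 Nw Nwhat; set t := (6 * j + k)%N.
  have ts : (t < 6 * s)%N.
    rewrite /t (@leq_trans (6 * j.+1)) // ?leq_mul2l ?js //.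
    by rewrite mulnS addnC ltn_add2r.
  have tj : (t %/ 6)%N = j by rewrite /t mulnC divnMDl // divn_small // addn0.
  have tk : (t %% 6)%N = k by rewrite /t mulnC modnMDl modn_small.
  have := good_run_nth om_good; rewrite size_tuple => /(_ t ts).
  rewrite /good /= size_takel ?size_tuple 1?ltnW // /wof /whatof tj tk.
  have outE : out (nth finset.set0 (take t om)) j = out Bs j.
    apply: svrg_outer_ext; apply: run_ext; last exact: ltnW.
    exact: leq_addr.
  have innE Q w' : inn (nth finset.set0 (take t om)) w' (6 * j)%N Q k = inn Bs w' (6 * j)%N Q k.
    by apply: svrg_inner_ext; apply: run_ext; last exact: ltnW.
  by rewrite outE innE (asboolT Nw) (asboolT Nwhat).
have [|Ns close] := @outer_loop R p n G nu M eps0 wstar n0 nu0 M0 eps0_range G2 fM Gnu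
  wstar_min P w0 P_spd Nw0 P_le P_ge bg 6 s (fun j => (out Bs j).1) bg0 isT erefl _ s (leqnn s).
  move=> j js; exists (fun k => Bs (6 * j + k)%N).
  exists (fun k => (inn Bs (out Bs j).1 (6 * j)%N (out Bs j).2 k).1); split=> // k k6.
  have ts : (6 * j + k < 6 * s)%N.
    rewrite (@leq_trans (6 * j.+1)) // ?leq_mul2l ?js //.
    by rewrite mulnS addnC ltn_add2r.
  split; [exact: sz | | exact: noise].
  apply: svrg_inner_step => //; last exact: sz.
    by move/eqP; rewrite muln_eq0 /= => /eqP ->.
  by rewrite muln_gt0 /= => j0; exact: svrg_outer_precond.
have gap := suboptimality_contracted n0 nu0 M0 eps0_range G2 fM Gnu wstar_min P_spd Nw0 P_le P_ge
  s0 Ns close.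
apply: le_trans gap _.
have gap_ge0 : 0 <= F w0 - F wstar by rewrite subr_ge0; exact: wstar_min.
have third : 3^-1 ^+ s <= eps * eps.
  have i3 : 3^-1 <= expR (- 1) :> R.
    by rewrite expRN lef_pV2 ?posrE ?expR_gt0 // expR1_le3.
  apply: (@le_trans _ _ (expR (- 1) ^+ s)).
    by rewrite lerXn2r ?nnegrE ?expR_ge0 ?invr_ge0.
  rewrite -expRM_natl mulrN1 -[eps]invrK -[eps^-1]lnK ?posrE ?invr_gt0 // -!expRN -expRD ler_expR.
  have aux (a b : R) : 2 * a <= b -> - b <= - a - a by move=> ?; lra.
  exact: aux.
(* Of the two factors [eps], one cancels the initial gap through [gap0] and the other is the target
   accuracy. *)
apply: le_trans (ler_wpM2r gap_ge0 third) _.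
by rewrite -mulrA -[leRHS]mulr1 ler_wpM2l // ltW.
Qed.
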